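(* Let $k$ be a field and let $V$ be the pro-finite-dimensional vector space $k[[t,t^{-1}]]$. The Plücker embedding realizes $\mathrm{Gr}(2,V)$ as the closed subscheme of $\mathbb{P}(\bigwedge^2 k[[t,t^{-1}]]^{\vee})$ given by the homogeneous equations $$\Delta^{ij}\Delta^{kl}-\Delta^{ik}\Delta^{jl}+\Delta^{il}\Delta^{jk}=0,\qquad i<k<j<l,$$ where $i,j,k,l$ range over the integers.
   Context: Vector spaces, algebras (commutative) and schemes are over the fixed arbitrary field $k$. $V=k[[t,t^{-1}]]$ is the space of formal series in $t,t^{-1}$, a pro-finite-dimensional (topological) vector space with topological basis $\{t^i\mid i\in\mathbb{Z}\}$; its topological dual $V^{\vee}$ is a discrete vector space with countable basis $\{\lambda_i\}_{i\in\mathbb{Z}}$ dual to $\{t^i\}$. For a vector space $W^{\vee}$ of arbitrary dimension, $\mathrm{Gr}(n,W)=\mathrm{Gr}(W^{\vee},n)$ is the functor sending an algebra $A$ to the set of (isomorphism classes of) locally free $A$-modules $U$ of rank $n$ together with a surjection $A\otimes W^{\vee}\twoheadrightarrow U$; it is represented by a scheme. For $n=1$ it is denoted $\mathbb{P}(W^{\vee})$. The Plücker embedding is the morphism $\mathrm{Gr}(V^{\vee},2)\to\mathbb{P}(\bigwedge^2V^{\vee})$ sending $\phi\colon A\otimes V^{\vee}\twoheadrightarrow U$ to $\bigwedge^2\phi\colon A\otimes\bigwedge^2V^{\vee}\twoheadrightarrow\bigwedge^2U$. The homogeneous coordinate ring of $\mathbb{P}(\bigwedge^2k[[t,t^{-1}]]^{\vee})$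 is the graded polynomial ring $k[\Delta^{ij}\mid i<j]$, $i,j\in\mathbb{Z}$, $\deg\Delta^{ij}=1$, where $\Delta^{ij}$ is the coefficient of $t^i\wedge t^j$ with respect to the topological basis $\{t^i\wedge t^j\}_{i<j}$ of $\bigwedge^2k[[t,t^{-1}]]$ (equivalently $\Delta^{ij}$ corresponds to $\lambda_i\wedge\lambda_j$). One sets $\Delta^{ji}=-\Delta^{ij}$. *)

(* Defs.v *)
From HB Require Import structures.
From mathcomp Require Import all_boot all_order all_algebra.
From mathcomp Require Import boolp classical_sets functions topology.
From mathcomp Require Import zify.

Set Implicit Arguments.
Unset Strict Implicit.
Unset Printing Implicit Defensive.

Import GRing.Theory.
Local Open Scope ring_scope.
Local Open Scope quotient_scope.

(* Rings are [comPzRingType]s throughout, so that the zero ring is allowed.   *)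

(* The R-module presented by generators X and by the relations that hold for  *)
(* every map g : X -> M with P g: formal linear combinations of elements of X *)
(* are identified when all such g send them to the same element.              *)
Section Presented.
Variables (R : comPzRingType) (X : choiceType).
Variable P : forall M : lmodType R, (X -> M) -> Prop.

Definition lincomb (M : lmodType R) (g : X -> M) (s : seq (R * X)) : M :=
  \sum_(p <- s) p.1 *: g p.2.

Definition pres_rel (s t : seq (R * X)) : bool :=
  `[< forall (M : lmodType R) (g : X -> M), P g -> lincomb g s = lincomb g t >].

Lemma pres_rel_equiv : equiv_class_of pres_rel.
Proof.
split.
- by move=> s; apply/asboolP.
- by move=> s t; apply/asboolP/asboolP => st M g Pg; rewrite st.
- move=> t s u /asboolP st /asboolP tu; apply/asboolP => M g Pg.
  by rewrite st // tu.
Qed.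

Canonical pres_equiv := EquivRelPack pres_rel_equiv.

Definition presented : Type := {eq_quot pres_equiv}.

HB.instance Definition _ := Choice.on presented.
HB.instance Definition _ := EqQuotient.on presented.

Definition pres_class (s : seq (R * X)) : presented := \pi_presented s.

Lemma pres_classE s t :
  pres_class s = pres_class t <->
  forall (M : lmodType R) (g : X -> M), P g -> lincomb g s = lincomb g t.
Proof.
rewrite /pres_class; split; first by move=> /eqquotP/asboolP.
by move=> st; apply/eqquotP/asboolP.
Qed.

Lemma lincomb_repr s (M : lmodType R) (g : X -> M) :
  P g -> lincomb g (repr (pres_class s)) = lincomb g s.
Proof. by move: M g; apply/pres_classE; rewrite /pres_class reprK. Qed.

Definition pres_zero : presented := pres_class [::].
Definition pres_opp (x : presented) : presented :=
  pres_class [seq (- p.1, p.2) | p <- repr x].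
Definition pres_add (x y : presented) : presented :=
  pres_class (repr x ++ repr y).
Definition pres_scale (a : R) (x : presented) : presented :=
  pres_class [seq (a * p.1, p.2) | p <- repr x].

Lemma lincomb0 (M : lmodType R) (g : X -> M) : lincomb g [::] = 0.
Proof. by rewrite /lincomb big_nil. Qed.

Lemma lincomb_cat (M : lmodType R) (g : X -> M) s t :
  lincomb g (s ++ t) = lincomb g s + lincomb g t.
Proof. by rewrite /lincomb big_cat. Qed.

Lemma lincombN (M : lmodType R) (g : X -> M) s :
  lincomb g [seq (- p.1, p.2) | p <- s] = - lincomb g s.
Proof.
by rewrite /lincomb big_map -sumrN; apply: eq_bigr => p _; rewrite scaleNr.
Qed.

Lemma lincombZ (M : lmodType R) (g : X -> M) a s :
  lincomb g [seq (a * p.1, p.2) | p <- s] = a *: lincomb g s.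
Proof.
by rewrite /lincomb big_map scaler_sumr; apply: eq_bigr => p _; rewrite scalerA.
Qed.

Lemma lincomb_ext (x y : presented) :
  (forall (M : lmodType R) (g : X -> M),
    P g -> lincomb g (repr x) = lincomb g (repr y)) -> x = y.
Proof. by move/pres_classE; rewrite /pres_class !reprK. Qed.

Let lcE := (lincomb_cat, lincombN, lincombZ, lincomb0).

Lemma pres_addA : associative pres_add.
Proof.
move=> x y z; apply: lincomb_ext => M g Pg.
by rewrite !(lincomb_repr, lcE) // addrA.
Qed.

Lemma pres_addC : commutative pres_add.
Proof.
move=> x y; apply: lincomb_ext => M g Pg.
by rewrite !(lincomb_repr, lcE) // addrC.
Qed.

Lemma pres_add0 : left_id pres_zero pres_add.
Proof.
move=> x; apply: lincomb_ext => M g Pg.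
by rewrite !(lincomb_repr, lcE) // add0r.
Qed.

Lemma pres_addN : left_inverse pres_zero pres_opp pres_add.
Proof.
move=> x; apply: lincomb_ext => M g Pg.
by rewrite !(lincomb_repr, lcE) // addNr.
Qed.

HB.instance Definition _ :=
  GRing.isZmodule.Build presented pres_addA pres_addC pres_add0 pres_addN.

Lemma pres_scaleA a b x : pres_scale a (pres_scale b x) = pres_scale (a * b) x.
Proof.
apply: lincomb_ext => M g Pg.
by rewrite !(lincomb_repr, lcE) // scalerA.
Qed.

Lemma pres_scale1 : left_id 1 pres_scale.
Proof.
move=> x; apply: lincomb_ext => M g Pg.
by rewrite !(lincomb_repr, lcE) // scale1r.
Qed.

Lemma pres_scaleDr : right_distributive pres_scale +%R.
Proof.
move=> a x y; apply: lincomb_ext => M g Pg.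
by rewrite !(lincomb_repr, lcE) // scalerDr.
Qed.

Lemma pres_scaleDl x : {morph pres_scale^~ x : a b / a + b}.
Proof.
move=> a b; apply: lincomb_ext => M g Pg.
by rewrite !(lincomb_repr, lcE) // scalerDl.
Qed.

HB.instance Definition _ := GRing.Zmodule_isLmodule.Build R presented
  pres_scaleA pres_scale1 pres_scaleDr pres_scaleDl.

Definition pres_gen (x : X) : presented := pres_class [:: (1, x)].

Section Lift.
Variables (M : lmodType R) (g : X -> M) (Pg : P g).

Definition pres_lift_fun of P g := fun x : presented => lincomb g (repr x).

Lemma pres_lift_linear : linear (pres_lift_fun Pg).
Proof. by move=> a x y; rewrite /pres_lift_fun !(lincomb_repr, lcE). Qed.

HB.instance Definition _ :=
  GRing.isLinear.Build R presented M *:%R (pres_lift_fun Pg) pres_lift_linear.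

Definition pres_lift : {linear presented -> M} := pres_lift_fun Pg.

Lemma pres_lift_gen x : pres_lift (pres_gen x) = g x.
Proof.
by rewrite /= /pres_lift_fun lincomb_repr // /lincomb big_seq1 scale1r.
Qed.

End Lift.

Lemma presP (x y : presented) :
  (forall (M : lmodType R) (g : X -> M) (Pg : P g),
    pres_lift Pg x = pres_lift Pg y) -> x = y.
Proof. by move=> xy; apply: lincomb_ext => M g Pg; apply: (xy M g Pg). Qed.

Lemma pres_span (x : presented) :
  exists s : seq (R * X), x = \sum_(p <- s) p.1 *: pres_gen p.2.
Proof.
exists (repr x); apply: presP => M g Pg.
rewrite linear_sum; apply: eq_bigr => p _.
by rewrite linearZ pres_lift_gen.
Qed.

End Presented.

Section Tensor.
Variables (R : comPzRingType) (M N : lmodType R).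

Definition bilinear_map (L : lmodType R) (b : M * N -> L) : Prop :=
  (forall m, linear (fun n => b (m, n))) /\
  (forall n, linear (fun m => b (m, n))).

Definition tensor : lmodType R := presented bilinear_map.

Definition tens (m : M) (n : N) : tensor := pres_gen bilinear_map (m, n).

Lemma tens_bilinear : bilinear_map (fun p => tens p.1 p.2).
Proof.
by split=> [m|n] a x y; apply: presP => L g Pg /=;
  rewrite linearP /= !pres_lift_gen; [apply: Pg.1 | apply: Pg.2].
Qed.

End Tensor.

Section Ext2.
Variables (R : comPzRingType) (M : lmodType R).

Definition alternating_map (L : lmodType R) (b : M * M -> L) : Prop :=
  bilinear_map b /\ forall m, b (m, m) = 0.

(* The exterior square of M over R. *)
Definition ext2 : lmodType R := presented alternating_map.

Definition wedge (m n : M) : ext2 := pres_gen alternating_map (m, n).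

Lemma wedge_alternating : alternating_map (fun p => wedge p.1 p.2).
Proof.
split; last first.
  by move=> m; apply: presP => L g Pg; rewrite pres_lift_gen raddf0; apply: Pg.2.
by split=> [m|n] a x y; apply: presP => L g Pg /=;
  rewrite linearP /= !pres_lift_gen; [apply: Pg.1.1 | apply: Pg.1.2].
Qed.

Lemma wedgeC m n : wedge n m = - wedge m n.
Proof.
have [[Pl Pr] Pa] := wedge_alternating; apply/eqP; rewrite -addr_eq0; apply/eqP.
have /= := Pa (1 *: m + n); rewrite (Pl _ 1 m n) /= (Pr m 1 m n) (Pr n 1 m n) /=.
by rewrite (Pa m) (Pa n) /= !scale1r add0r addr0.
Qed.

End Ext2.

(* The localization U_f of an A-module U away from f: fractions u / f ^ m,    *)
(* where u / f ^ m = v / f ^ n iff some power of f kills f ^ n u - f ^ m v.   *)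
Section Localization.
Variables (A : comPzRingType) (f : A) (U : lmodType A).

Definition loc_rel (x y : U * nat) : bool :=
  `[< exists p, f ^+ (p + y.2) *: x.1 = f ^+ (p + x.2) *: y.1 >].

Lemma loc_rel_equiv : equiv_class_of loc_rel.
Proof.
split.
- by move=> x; apply/asboolP; exists 0%N.
- by move=> x y; apply/asboolP/asboolP => -[p xy]; exists p.
- move=> [v n] [u m] [w q] /asboolP[/= p uv] /asboolP[/= r vw].
  apply/asboolP; exists (p + r + n)%N => /=.
  have -> : (p + r + n + q = (r + q) + (p + n))%N.
    by rewrite addnAC [RHS]addnC addnA addnAC -!addnA; congr addn; rewrite addnCA.
  rewrite exprD -scalerA uv scalerA mulrC -scalerA vw scalerA -exprD.
  by congr (f ^+ _ *: _); rewrite addnAC addnA addnAC.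
Qed.

Canonical loc_equiv := EquivRelPack loc_rel_equiv.

Definition loc : Type := {eq_quot loc_equiv}.

HB.instance Definition _ := Choice.on loc.
HB.instance Definition _ := EqQuotient.on loc.

(* u / f ^ m *)
Definition frac (u : U) (m : nat) : loc := \pi_loc (u, m).

Lemma fracP u m v n :
  frac u m = frac v n <-> exists p, f ^+ (p + n) *: u = f ^+ (p + m) *: v.
Proof.
by split=> [/eqquotP/asboolP|uv]; last by apply/eqquotP/asboolP.
Qed.

Lemma fracE (x : loc) : x = frac (repr x).1 (repr x).2.
Proof. by rewrite /frac -surjective_pairing reprK. Qed.

Lemma frac_ind (P : loc -> Prop) : (forall u m, P (frac u m)) -> forall x, P x.
Proof. by move=> Pf x; rewrite (fracE x). Qed.

Definition loc_zero : loc := frac 0 0.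
Definition loc_opp (x : loc) : loc := frac (- (repr x).1) (repr x).2.
Definition loc_add (x y : loc) : loc :=
  frac (f ^+ (repr y).2 *: (repr x).1 + f ^+ (repr x).2 *: (repr y).1)
    ((repr x).2 + (repr y).2).

Lemma repr_frac u m : exists p,
  f ^+ (p + m) *: (repr (frac u m)).1 = f ^+ (p + (repr (frac u m)).2) *: u.
Proof. by apply/fracP; rewrite -fracE. Qed.

Lemma loc_oppE u m : loc_opp (frac u m) = frac (- u) m.
Proof.
by have [p E] := repr_frac u m; apply/fracP; exists p; rewrite !scalerN E.
Qed.

Lemma loc_addE u m v n :
  loc_add (frac u m) (frac v n) = frac (f ^+ n *: u + f ^+ m *: v) (m + n).
Proof.
have [p E] := repr_frac u m; have [q F] := repr_frac v n.
rewrite /loc_add; move: (repr _).1 (repr _).2 E => u' m' E.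
move: (repr _).1 (repr _).2 F => v' n' F.
apply/fracP; exists (p + q)%N; rewrite !scalerDr !scalerA.
congr (_ + _).
  have -> : f ^+ (p + q + (m + n)) * f ^+ n' = f ^+ (q + n + n') * f ^+ (p + m).
    by rewrite -!exprD; congr (_ ^+ _); lia.
  rewrite -scalerA E scalerA; congr (_ *: _).
  by rewrite -!exprD; congr (_ ^+ _); lia.
have -> : f ^+ (p + q + (m + n)) * f ^+ m' = f ^+ (p + m + m') * f ^+ (q + n).
  by rewrite -!exprD; congr (_ ^+ _); lia.
rewrite -scalerA F scalerA; congr (_ *: _).
by rewrite -!exprD; congr (_ ^+ _); lia.
Qed.

Lemma loc_addA : associative loc_add.
Proof.
elim/frac_ind=> u m; elim/frac_ind=> v n; elim/frac_ind=> w q.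
rewrite !loc_addE addnA !scalerDr !scalerA addrA -!exprD.
by congr (frac (_ *: _ + _ *: _ + _) _); congr (f ^+ _); rewrite addnC.
Qed.

Lemma loc_addC : commutative loc_add.
Proof.
by elim/frac_ind=> u m; elim/frac_ind=> v n; rewrite !loc_addE addrC addnC.
Qed.

Lemma loc_add0 : left_id loc_zero loc_add.
Proof.
by elim/frac_ind=> u m; rewrite loc_addE scaler0 add0r scale1r.
Qed.

Lemma loc_addN : left_inverse loc_zero loc_opp loc_add.
Proof.
elim/frac_ind=> u m; rewrite loc_oppE loc_addE scalerN addNr.
by apply/fracP; exists 0%N; rewrite !scaler0.
Qed.

HB.instance Definition _ :=
  GRing.isZmodule.Build loc loc_addA loc_addC loc_add0 loc_addN.

End Localization.

Section LocalizationRing.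
Variables (A : comPzRingType) (f : A).

Definition loc_ring : Type := loc f A^o.

HB.instance Definition _ := GRing.Zmodule.on loc_ring.

Definition frac_ring (a : A) (m : nat) : loc_ring := frac f (a : A^o) m.

Lemma frac_ring_ind (P : loc_ring -> Prop) :
  (forall a m, P (frac_ring a m)) -> forall x, P x.
Proof. exact: (@frac_ind A f A^o P). Qed.

Section Action.
Variable U : lmodType A.

Definition loc_scale (x : loc_ring) (y : loc f U) : loc f U :=
  frac f (((repr x).1 : A) *: (repr y).1) ((repr x).2 + (repr y).2).

Lemma loc_scaleE a m u n :
  loc_scale (frac_ring a m) (frac f u n) = frac f (a *: u) (m + n).
Proof.
have [p E] := repr_frac f (a : A^o) m; have [q F] := repr_frac f u n.
rewrite /loc_scale; move: (repr _).1 (repr _).2 E => a' m' E.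
move: (repr _).1 (repr _).2 F => u' n' F.
apply/fracP; exists (p + q)%N; rewrite !scalerA.
have -> : f ^+ (p + q + (m + n)) * a' = (f ^+ (p + m) * a') * f ^+ (q + n).
  by rewrite mulrAC -exprD; congr (_ ^+ _ * _); lia.
have {}E : f ^+ (p + m) * a' = f ^+ (p + m') * a := E.
rewrite E -scalerA F scalerA; congr (_ *: _).
by rewrite mulrAC -exprD; congr (_ ^+ _ * _); lia.
Qed.

End Action.

Definition loc_mul (x y : loc_ring) : loc_ring := loc_scale x y.

Definition loc_one : loc_ring := frac_ring 1 0.

Lemma loc_mulE a b m n :
  loc_mul (frac_ring a m) (frac_ring b n) = frac_ring (a * b) (m + n).
Proof. exact: loc_scaleE. Qed.

Lemma loc_scaleA (U : lmodType A) x y (z : loc f U) :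
  loc_scale x (loc_scale y z) = loc_scale (loc_mul x y) z.
Proof.
move: x; apply: frac_ring_ind => a m; move: y; apply: frac_ring_ind => b n.
elim/frac_ind: z => u q.
by rewrite loc_mulE !loc_scaleE scalerA addnA.
Qed.

Lemma loc_scale1 (U : lmodType A) : left_id loc_one (@loc_scale U).
Proof. by elim/frac_ind=> u m; rewrite loc_scaleE scale1r. Qed.

Lemma loc_addrE (U : lmodType A) (u v : U) m n :
  frac f u m + frac f v n = frac f (f ^+ n *: u + f ^+ m *: v) (m + n).
Proof. exact: loc_addE. Qed.

Lemma loc_ring_addrE a b m n :
  frac_ring a m + frac_ring b n = frac_ring (f ^+ n * a + f ^+ m * b) (m + n).
Proof. exact: loc_addE. Qed.

Lemma loc_scaleDr (U : lmodType A) : right_distributive (@loc_scale U) +%R.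
Proof.
apply: frac_ring_ind => a m; elim/frac_ind=> u n; elim/frac_ind=> v q.
rewrite (loc_addrE u v) !loc_scaleE (@loc_addrE U).
apply/fracP; exists 0%N; rewrite !scalerDr !scalerA.
by congr (_ *: _ + _ *: _); rewrite [LHS]mulrAC -!exprD;
  congr (_ ^+ _ * _); lia.
Qed.

Lemma loc_scaleDl (U : lmodType A) (z : loc f U) :
  {morph (@loc_scale U)^~ z : x y / x + y}.
Proof.
move=> x y.
move: x; apply: frac_ring_ind => a m; move: y; apply: frac_ring_ind => b n.
elim/frac_ind: z => u q.
rewrite loc_ring_addrE !loc_scaleE !(@loc_addrE U).
apply/fracP; exists 0%N; rewrite !scalerDl !scalerDr !scalerA.
by congr (_ *: _ + _ *: _); rewrite !mulrA -!exprD; congr (_ ^+ _ * _); lia.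
Qed.

Lemma loc_mulC : commutative loc_mul.
Proof.
apply: frac_ring_ind => a m; apply: frac_ring_ind => b n.
by rewrite !loc_mulE mulrC addnC.
Qed.

HB.instance Definition _ := GRing.Zmodule_isComPzRing.Build loc_ring
  (@loc_scaleA A^o) loc_mulC (@loc_scale1 A^o)
  (fun x y z => @loc_scaleDl A^o z x y).

HB.instance Definition _ (U : lmodType A) :=
  GRing.Zmodule_isLmodule.Build loc_ring (loc f U)
    (@loc_scaleA U) (@loc_scale1 U) (@loc_scaleDr U) (@loc_scaleDl U).

End LocalizationRing.

Definition locally_free (n : nat) (A : comPzRingType) (U : lmodType A) : Prop :=
  exists s : seq A,
    (exists c : A -> A, \sum_(f <- s) c f * f = 1) /\
    forall f, f \in s ->
      exists h : {linear loc f U -> 'rV[loc_ring f]_n}, bijective h.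

Section BaseChange.
Variables (R S : comPzRingType) (iota : {rmorphism R -> S}).

(* An S-module viewed as an R-module along iota. *)
Section Restriction.
Variable M : lmodType S.

Definition restr_scal of {rmorphism R -> S} : Type := M.

HB.instance Definition _ := GRing.Zmodule.on (restr_scal iota).

Definition restr_scale (r : R) (m : restr_scal iota) : restr_scal iota :=
  iota r *: (m : M).

Lemma restr_scaleA a b m :
  restr_scale a (restr_scale b m) = restr_scale (a * b) m.
Proof. by rewrite /restr_scale scalerA rmorphM. Qed.

Lemma restr_scale1 : left_id 1 restr_scale.
Proof. by move=> m; rewrite /restr_scale rmorph1 scale1r. Qed.

Lemma restr_scaleDr : right_distributive restr_scale +%R.
Proof. by move=> a m n; rewrite /restr_scale scalerDr. Qed.

Lemma restr_scaleDl m : {morph restr_scale^~ m : a b / a + b}.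
Proof. by move=> a b; rewrite /restr_scale rmorphD scalerDl. Qed.

HB.instance Definition _ := GRing.Zmodule_isLmodule.Build R (restr_scal iota)
  restr_scaleA restr_scale1 restr_scaleDr restr_scaleDl.

End Restriction.

Variable M : lmodType R.

Definition balanced_map (L : lmodType S) (b : S * M -> L) : Prop :=
  [/\ forall m, linear (fun s : S^o => b (s, m)),
      forall s m n, b (s, m + n) = b (s, m) + b (s, n) &
      forall s r m, b (s * iota r, m) = b (s, r *: m)].

(* The tensor product of S and M over R, as an S-module. *)
Definition base_change : lmodType S := presented balanced_map.

Definition bc_tens (s : S) (m : M) : base_change :=
  pres_gen balanced_map (s, m).

Lemma bc_tens_balanced : balanced_map (fun p => bc_tens p.1 p.2).
Proof.
split=> [m a x y|s m n|s r m]; apply: presP => L g Pg /=;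
  have [P1 P2 P3] := Pg.
- by rewrite linearP /= !pres_lift_gen P1.
- by rewrite linearD /= !pres_lift_gen P2.
- by rewrite !pres_lift_gen P3.
Qed.

Lemma bc_tensZl a s m : bc_tens (a * s) m = a *: bc_tens s m.
Proof.
by have [P1 _ _] := bc_tens_balanced; apply: (GRing.scalable_linear (P1 m)).
Qed.

Lemma bc_tensDr s m n : bc_tens s (m + n) = bc_tens s m + bc_tens s n.
Proof. by have [_ P2 _] := bc_tens_balanced; apply: P2. Qed.

Lemma bc_tensZr s r m : bc_tens s (r *: m) = iota r *: bc_tens s m.
Proof.
have [_ _ P3] := bc_tens_balanced.
by rewrite -(P3 s r m) /= mulrC bc_tensZl.
Qed.

Section Lift.
Variables (N : lmodType S) (g : M -> N)
  (g_lin : linear (g : M -> restr_scal N iota)).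

Definition bc_lift_gen (p : S * M) : N := p.1 *: g p.2.

Lemma bc_lift_balanced : balanced_map bc_lift_gen.
Proof.
split=> [m a x y|s m n|s r m]; rewrite /bc_lift_gen /=.
- by rewrite scalerDl scalerA.
- have := g_lin 1 m n; rewrite !scale1r => ->; exact: scalerDr.
- rewrite -scalerA; congr (s *: _); apply/esym.
  exact: (GRing.scalable_linear g_lin).
Qed.

(* The S-linear extension of an R-linear map from M to an S-module. *)
Definition bc_lift : {linear base_change -> N} := pres_lift bc_lift_balanced.

Lemma bc_liftE s m : bc_lift (bc_tens s m) = s *: g m.
Proof. exact: (pres_lift_gen bc_lift_balanced). Qed.

End Lift.

End BaseChange.

Section Ext2Map.
Variables (R : comPzRingType) (M N : lmodType R) (h : {linear M -> N}).

Definition ext2_map_gen (p : M * M) : ext2 N := wedge (h p.1) (h p.2).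

Lemma ext2_map_alt : alternating_map ext2_map_gen.
Proof.
have [[Bl Br] Ba] := wedge_alternating N.
split; last by move=> m; apply: Ba.
by split=> m a x y; rewrite /ext2_map_gen /= linearP; [apply: Bl | apply: Br].
Qed.

Definition ext2_map : {linear ext2 M -> ext2 N} := pres_lift ext2_map_alt.

Lemma ext2_mapE m n : ext2_map (wedge m n) = wedge (h m) (h n).
Proof. exact: (pres_lift_gen ext2_map_alt). Qed.

End Ext2Map.

(* The canonical map from S (x) /\^2 M to /\^2 (S (x) M), both squares being  *)
(* over the respective base rings; it sends s (x) (m /\ n) to                 *)
(* s ((1 (x) m) /\ (1 (x) n)).                                                *)
Section Ext2BaseChange.
Variables (R S : comPzRingType) (iota : {rmorphism R -> S}) (M : lmodType R).

Definition ext2_bc_gen (p : M * M) : restr_scal (ext2 (base_change iota M)) iota :=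
  wedge (bc_tens iota 1 p.1) (bc_tens iota 1 p.2).

Lemma ext2_bc_alt : alternating_map ext2_bc_gen.
Proof.
have [[Bl Br] Ba] := wedge_alternating (base_change iota M).
split; last by move=> m; apply: Ba.
split=> m a x y; rewrite /ext2_bc_gen /= bc_tensDr bc_tensZr.
  exact: Bl.
exact: Br.
Qed.

Definition ext2_bc_base :
    {linear ext2 M -> restr_scal (ext2 (base_change iota M)) iota} :=
  pres_lift ext2_bc_alt.

Definition ext2_bc :
    {linear base_change iota (ext2 M) -> ext2 (base_change iota M)} :=
  bc_lift (linearP ext2_bc_base).

Lemma ext2_bcE s m n :
  ext2_bc (bc_tens iota s (wedge m n)) =
  s *: wedge (bc_tens iota 1 m) (bc_tens iota 1 n).
Proof.
by rewrite bc_liftE; congr (_ *: _); apply: (pres_lift_gen ext2_bc_alt).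
Qed.

End Ext2BaseChange.

(* A commutative algebra over k. *)
Record kalg (k : fieldType) := KAlg {
  kalg_ring :> comPzRingType;
  kalg_map : {rmorphism k -> kalg_ring}
}.

Record kalg_hom (k : fieldType) (A B : kalg k) := KAlgHom {
  kalg_hom_fun :> {rmorphism A -> B};
  kalg_homE : forall c, kalg_hom_fun (kalg_map A c) = kalg_map B c
}.

(* An A-module U together with an A-linear map from A (x)_k W to U. *)
Record qfamily (k : fieldType) (W : lmodType k) (A : kalg k) := QFamily {
  fam_mod : lmodType A;
  fam_map : {linear base_change (kalg_map A) W -> fam_mod}
}.

Section Families.
Variables (k : fieldType) (W : lmodType k).

Definition fam_iso (A : kalg k) (F G : qfamily W A) : Prop :=
  exists h : {linear fam_mod F -> fam_mod G},
    bijective h /\ forall x, h (fam_map F x) = fam_map G x.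

(* F represents an A-point of Gr(W, n): the set Gr(W, n)(A) is the set of     *)
(* such F modulo fam_iso.                                                     *)
Definition Gr_point (n : nat) (A : kalg k) (F : qfamily W A) : Prop :=
  locally_free n (fam_mod F) /\ forall u, exists x, fam_map F x = u.

Definition P_point (A : kalg k) (F : qfamily W A) : Prop := Gr_point 1 F.

Section Pullback.
Variables (A B : kalg k) (h : kalg_hom A B) (F : qfamily W A).

Definition pullback_gen (w : W) : base_change h (fam_mod F) :=
  bc_tens h 1 (fam_map F (bc_tens (kalg_map A) 1 w)).

Lemma pullback_linear :
  linear (pullback_gen : W -> restr_scal (base_change h (fam_mod F)) (kalg_map B)).
Proof.
move=> c v w; rewrite /pullback_gen bc_tensDr bc_tensZr linearP bc_tensDr bc_tensZr.
by rewrite kalg_homE.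
Qed.

(* B (x)_k W = B (x)_A (A (x)_k W) -> B (x)_A U *)
Definition pullback : qfamily W B := QFamily (bc_lift pullback_linear).

End Pullback.

(* A (x) /\^2 W -> /\^2 (A (x) W) -> /\^2 U *)
Definition plucker (A : kalg k) (F : qfamily W A) : qfamily (ext2 W) A :=
  QFamily (ext2_map (fam_map F) \o ext2_bc (kalg_map A) W).

End Families.

Local Open Scope classical_set_scope.

Section Biseries.
Variable k : fieldType.

(* k[[t, t^-1]]: the formal series \sum_i v_i t ^ i over all integers i, with *)
(* the product topology, k being discrete.                                    *)
Definition biseries : Type := int -> k^o.

HB.instance Definition _ := GRing.Lmodule.copy biseries (int -> k^o).
HB.instance Definition _ :=
  Topological.copy biseries {ptws int -> discrete_topology k}.

Definition tpow (i : int) : biseries := fun j => (j == i)%:R.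

Definition in_dual : {pred biseries -> k^o} := fun l =>
  `[< linear l /\ continuous (l : biseries -> discrete_topology k) >].

Lemma continuous_discreteP (l : biseries -> discrete_topology k) :
  continuous l <-> forall v, \forall w \near v, l w = l v.
Proof.
split=> [cl v|cl v].
  suff /(cl v) : nbhs (l v) [set l v] by [].
  exact/principal_filterP.
move=> X /principal_filterP Xv; apply: filterS (cl v) => w /= ->.
exact: Xv.
Qed.

Fact in_dual_submod : submod_closed in_dual.
Proof.
split; first apply/asboolP; first split.
- move=> a u v; change (0 = a *: 0 + 0 :> k^o).
  by rewrite scaler0 addr0.
- by apply/continuous_discreteP => v; apply: (@nearW _ (nbhs v)).
- move=> a l m /asboolP[ll /continuous_discreteP lc].
  move=> /asboolP[ml /continuous_discreteP mc]; apply/asboolP; split.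
    move=> b u v.
    change (a *: l (b *: u + v) + m (b *: u + v) =
      b *: (a *: l u + m u) + (a *: l v + m v)).
    by rewrite ll ml !scalerDr !scalerA [b * a]mulrC addrACA.
  apply/continuous_discreteP => v.
  apply: filterS2 (lc v) (mc v) => w lw mw.
  by change (a *: l w + m w = a *: l v + m v); rewrite lw mw.
Qed.

HB.instance Definition _ :=
  GRing.isSubmodClosed.Build k (biseries -> k^o) in_dual in_dual_submod.

(* The topological dual of k[[t, t^-1]]. *)
Record biseries_dual : Type := BiseriesDual {
  dual_fun :> biseries -> k^o;
  _ : dual_fun \in in_dual
}.

HB.instance Definition _ := [isSub for dual_fun].
HB.instance Definition _ := [Choice of biseries_dual by <:].
HB.instance Definition _ := [SubChoice_isSubLmodule of biseries_dual by <:].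

Fact lambda_in_dual i : (fun v : biseries => v i) \in in_dual.
Proof.
apply/asboolP; split; first by move=> a u v.
exact: (@proj_continuous _ (fun _ => discrete_topology k) i).
Qed.

Definition lambda_ (i : int) : biseries_dual := BiseriesDual (lambda_in_dual i).

Lemma lambda_tpow i j : lambda_ i (tpow j) = (i == j)%:R.
Proof. by []. Qed.

End Biseries.

(* The homogeneous coordinate Delta^{ij} of a point of the projective space   *)
(* P(/\^2 V), where V denotes the dual of K[[t, t^-1]]: the section of its    *)
(* line bundle given by lambda_i /\ lambda_j. No order on i and j is assumed, *)
(* so that Delta^{ji} = - Delta^{ij} (DeltaC).                                *)
Definition Delta (K : fieldType) (A : kalg K)
    (F : qfamily (ext2 (biseries_dual K)) A) (i j : int) : fam_mod F :=
  fam_map F (bc_tens (kalg_map A) 1 (wedge (lambda_ K i) (lambda_ K j))).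

Lemma DeltaC (K : fieldType) (A : kalg K)
    (F : qfamily (ext2 (biseries_dual K)) A) (i j : int) :
  Delta F j i = - Delta F i j.
Proof.
by rewrite /Delta wedgeC -scaleN1r bc_tensZr rmorphN1 scaleN1r linearN.
Qed.

(* The A-points of the closed subscheme given by homogeneous equations of     *)
(* degree 2 in the Delta^{ij}: their left-hand sides are sections of O(2),    *)
(* hence elements of the tensor square of the line bundle of a point.         *)
Definition plucker_equations (K : fieldType) (A : kalg K)
    (F : qfamily (ext2 (biseries_dual K)) A) : Prop :=
  forall i j k l : int, (i < k)%R -> (k < j)%R -> (j < l)%R ->
    tens (Delta F i j) (Delta F k l) - tens (Delta F i k) (Delta F j l)
      + tens (Delta F i l) (Delta F j k) = 0.

(* Main.v *)
From HB Require Import structures.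
From mathcomp Require Import all_boot all_order all_algebra.
From mathcomp Require Import boolp classical_sets functions topology.
From mathcomp Require Import zify ring.
Require Import Defs.

Set Implicit Arguments.
Unset Strict Implicit.
Unset Printing Implicit Defensive.

Import Order.TTheory GRing.Theory Num.Theory.
Local Open Scope ring_scope.

(** The Plücker map is natural because exterior squares commute with base change
    ([ext2_bc_bij]). Its image satisfies the Plücker equations because these may
    be checked locally, where a module of rank two has a basis and they become
    an identity between minors ([rank2_plucker]). It is injective on points
    because the kernel of a rank two quotient consists of the x whose wedge with
    every y maps to zero ([plucker_inj]).

    For surjectivity, a point of projective space is an alternating form [D] on
    M = A (x) V with values in a line bundle [L]. Every continuous functional on
    the formal series is a finite combination of coordinates ([dual_lambda]), so
    the equations, given on increasing quadruples of basis vectors, hold on all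
    of M: the Plücker form is multilinear and alternating
    ([plucker_form_sorted], [plucker_form_span]). The wanted plane is the
    quotient of M by the radical of [D]. On the open set where D (v, w)
    generates [L], Cramer's rule, which is a form of the Plücker relation, shows
    that the classes of v and w are a basis ([chart]); these open sets cover
    ([chart_cover]) because [D] generates [L]. As M has infinite rank, one has to
    know that the radical is compatible with localization, which holds because
    it is cut out by finitely many linear equations ([D_radical_fin]). The form
    then descends to an isomorphism from the exterior square of the quotient to
    [L] ([ext2_quo]).

    Local freeness is used through denominator-free local bases
    ([locally_freeP]), and local statements are glued by [ideal_cover]. *)

(** * Partitions of unity *)

Section Covers.
Variable A : comPzRingType.

Definition covers (s : seq A) : Prop := exists c : A -> A, \sum_(f <- s) c f * f = 1.

Definition ideal (Q : A -> Prop) : Prop :=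
  [/\ Q 0, forall a b, Q a -> Q b -> Q (a + b) & forall c a, Q a -> Q (c * a)].

Lemma ideal_sum (Q : A -> Prop) (I : eqType) (s : seq I) (F : I -> A) :
  ideal Q -> (forall i, i \in s -> Q (F i)) -> Q (\sum_(i <- s) F i).
Proof. by case=> Q0 QD _ QF; rewrite big_seq; apply: big_ind. Qed.

Lemma radical_ideal (Q : A -> Prop) :
  ideal Q -> ideal (fun a => exists n, Q (a ^+ n)).
Proof.
move=> Qi; have [Q0 QD QM] := Qi; split; first by exists 1%N.
  move=> a b [m Qa] [n Qb]; exists (m + n)%N; rewrite exprDn.
  have QMn x r : Q x -> Q (x *+ r) by move=> Qx; rewrite -mulr_natl; apply: QM.
  apply: ideal_sum => // i _; apply: QMn; have [ni|/ltnW im] := leqP n i.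
    by rewrite -(subnK ni) exprD mulrA; apply: QM.
  have mi : (m <= m + n - i)%N by lia.
  by rewrite mulrC -(subnK mi) exprD mulrA; apply: QM.
by move=> c a [n Qa]; exists n; rewrite exprMn; apply: QM.
Qed.

(** The partition of unity argument. The elements with a power in [Q] form the
    radical of [Q], which contains a family generating the unit ideal. Every
    local-to-global step below is an instance: [Q] is an annihilator, or the
    ideal generated by a new cover. *)
Lemma ideal_cover (Q : A -> Prop) (s : seq A) :
  ideal Q -> covers s -> (forall f, f \in s -> exists n, Q (f ^+ n)) -> Q 1.
Proof.
move=> /radical_ideal Ri [c c1] sQ.
have [] : exists n, Q (1 ^+ n); last by move=> n; rewrite expr1n.
rewrite -c1; apply: (ideal_sum Ri) => f fs.
by have [_ _ RM] := Ri; apply: RM; apply: sQ.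
Qed.

Lemma eq0_cover (s : seq A) (M : lmodType A) (x : M) :
  covers s -> (forall f, f \in s -> exists n, f ^+ n *: x = 0) -> x = 0.
Proof.
move=> sc sx; rewrite -[x]scale1r; apply: (ideal_cover (Q := fun a => a *: x = 0) _ sc sx).
split=> [|a b xa xb|c a xa]; first exact: scale0r.
  by rewrite scalerDl xa xb addr0.
by rewrite -scalerA xa scaler0.
Qed.

Definition ideal_gen (P : A -> Prop) (a : A) : Prop :=
  exists2 s : seq (A * A), (forall p, p \in s -> P p.2) & a = \sum_(p <- s) p.1 * p.2.

Lemma ideal_genP (P : A -> Prop) : ideal (ideal_gen P).
Proof.
split.
- by exists [::]; rewrite ?big_nil.
- move=> a b [s sP ->] [t tP ->]; exists (s ++ t); last by rewrite big_cat.
  by move=> p; rewrite mem_cat => /orP[/sP|/tP].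
- move=> c a [s sP ->]; exists [seq (c * p.1, p.2) | p <- s].
    by move=> p /mapP[q /sP qP ->].
  by rewrite big_map mulr_sumr; apply: eq_bigr => p _; rewrite mulrA.
Qed.

Lemma ideal_gen_cover (P : A -> Prop) : ideal_gen P 1 ->
  exists2 s, covers s & forall f, f \in s -> P f.
Proof.
case=> s sP s1; exists (undup (map snd s)); last first.
  by move=> f; rewrite mem_undup => /mapP[p /sP Pp ->].
exists (fun f => \sum_(p <- s | p.2 == f) p.1); rewrite s1.
under eq_bigr => f _ do rewrite mulr_suml.
rewrite (exchange_big_dep predT) //= big_seq [RHS]big_seq.
apply: eq_bigr => p ps.
rewrite big_mkcond (bigD1_seq p.2) ?undup_uniq ?mem_undup ?map_f //= eqxx.
by rewrite big1 ?addr0 // => g /negPf; rewrite eq_sym => ->.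
Qed.

End Covers.

(** * Localizations and local bases *)

Section LocMap.
Variables (A : comPzRingType) (f : A).

Definition loc_map (a : A) : loc_ring f := frac_ring f a 0.

Fact loc_map_zmod : zmod_morphism loc_map.
Proof.
move=> a b; have -> : - loc_map b = loc_map (- b) by exact: loc_oppE.
by rewrite /loc_map loc_ring_addrE !expr0 !mul1r.
Qed.

Fact loc_map_monoid : monoid_morphism loc_map.
Proof. by split=> // a b; rewrite /loc_map [RHS]loc_mulE. Qed.

HB.instance Definition _ := GRing.isZmodMorphism.Build A (loc_ring f) loc_map loc_map_zmod.
HB.instance Definition _ := GRing.isMonoidMorphism.Build A (loc_ring f) loc_map loc_map_monoid.

Lemma fracZ (U : lmodType A) a m (u : U) n :
  frac_ring f a m *: frac f u n = frac f (a *: u) (m + n).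
Proof. exact: loc_scaleE. Qed.

Lemma frac_eq0 (U : lmodType A) (u : U) n :
  frac f u n = 0 <-> exists N, f ^+ N *: u = 0.
Proof.
split=> [/fracP[p]|[N uN]]; first by rewrite scaler0 addn0 => pu; exists p.
by apply/fracP; exists N; rewrite scaler0 addn0.
Qed.

Lemma frac_ring_eq0 (a : A) n :
  frac_ring f a n = 0 <-> exists N, f ^+ N * a = 0.
Proof. exact: (frac_eq0 (a : A^o) n). Qed.

Lemma frac_mul N (U : lmodType A) (u : U) n : frac f (f ^+ N *: u) (N + n) = frac f u n.
Proof. by apply/fracP; exists 0%N; rewrite scalerA -exprD add0n addnC. Qed.

Lemma fracD (U : lmodType A) (u v : U) n : frac f (u + v) n = frac f u n + frac f v n.
Proof.
rewrite loc_addrE -scalerDr; apply/fracP; exists 0%N.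
by rewrite !scalerA -!exprD.
Qed.

Lemma frac_sum (U : lmodType A) n (I : Type) (r : seq I) (P : pred I) (F : I -> U) :
  frac f (\sum_(i <- r | P i) F i) n = \sum_(i <- r | P i) frac f (F i) n.
Proof.
apply: (big_morph (fun u => frac f u n)) => [u v|]; first exact: fracD.
by apply/frac_eq0; exists 0%N; rewrite scaler0.
Qed.

Lemma frac_common n (x : 'I_n -> loc_ring f) :
  exists a N, forall i, x i = frac_ring f (a i) N.
Proof.
have /choice[b bP] : forall i, exists p : A * nat, x i = frac_ring f p.1 p.2.
  by move=> i; elim/frac_ring_ind: (x i) => a m; exists (a, m).
pose N := (\sum_i (b i).2)%N.
exists (fun i => f ^+ (N - (b i).2) * (b i).1), N => i.
rewrite bP -{2}(subnK (_ : (b i).2 <= N)%N); last by rewrite /N (bigD1 i) //= leq_addr.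
exact/esym/(frac_mul _ ((b i).1 : A^o)).
Qed.

End LocMap.

Section LocalBasis.
Variables (A : comPzRingType) (f : A) (U : lmodType A) (n : nat).

(** The images of the [e i] form a basis of the localization [loc f U]; said
    without denominators, so that it can be used in [U] itself. *)
Definition local_basis (e : 'I_n -> U) : Prop :=
  (forall u, exists N (a : 'I_n -> A), f ^+ N *: u = \sum_i a i *: e i) /\
  (forall a : 'I_n -> A, \sum_i a i *: e i = 0 -> forall i, exists N, f ^+ N * a i = 0).

Section Coord.
Variables (e : 'I_n -> U) (eP : local_basis e).

Definition frac_comb (v : 'rV[loc_ring f]_n) : loc f U :=
  \sum_i v 0 i *: frac f (e i) 0.

Fact frac_comb_linear : linear frac_comb.
Proof.
move=> a v w; rewrite /frac_comb scaler_sumr -big_split; apply: eq_bigr => i _.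
by rewrite !mxE scalerDl scalerA.
Qed.

HB.instance Definition _ :=
  GRing.isLinear.Build (loc_ring f) 'rV[loc_ring f]_n (loc f U) *:%R frac_comb frac_comb_linear.

Lemma frac_comb_bij : bijective frac_comb.
Proof.
have [eS eI] := eP.
have inj : injective frac_comb.
  apply: raddf_inj => v v0; apply/rowP => i; rewrite mxE.
  have [a [N vE]] := frac_common (fun i => v 0 i).
  move: v0; rewrite /= /frac_comb; under eq_bigr => j _ do rewrite vE fracZ addn0.
  rewrite -frac_sum => /frac_eq0[m]; rewrite scaler_sumr.
  under eq_bigr => j _ do rewrite scalerA.
  move=> /eI/(_ i)[q]; rewrite vE => q0.
  by apply/frac_ring_eq0; exists (q + m)%N; rewrite exprD -mulrA.
have sur : forall y, exists x, frac_comb x = y.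
  elim/frac_ind=> u m; have [N [a ua]] := eS u.
  exists (\row_i frac_ring f (a i) (N + m)); rewrite /frac_comb.
  under eq_bigr => j _ do rewrite mxE fracZ addn0.
  by rewrite -frac_sum -ua frac_mul.
have /choice[g gP] := sur.
by exists g => // v; apply: inj; rewrite gP.
Qed.

End Coord.

End LocalBasis.

Lemma linear_inv (R : pzRingType) (M N : lmodType R) (h : {linear M -> N}) :
  bijective h -> exists g : {linear N -> M}, cancel h g /\ cancel g h.
Proof.
case=> g hg gh; have gl : linear g by apply: can2_linear hg gh.
pose G : {linear N -> M} := HB.pack g (GRing.isLinear.Build _ _ _ _ _ gl).
by exists G.
Qed.

Lemma local_basis_iso (A : comPzRingType) (f : A) (U : lmodType A) n (e : 'I_n -> U) :
  local_basis f e ->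
  exists h : {linear loc f U -> 'rV[loc_ring f]_n},
    bijective h /\ forall i, h (frac f (e i) 0) = delta_mx 0 i.
Proof.
move=> eP; have bij := frac_comb_bij eP.
have [h [gh hg]] := linear_inv (bij : bijective (frac_comb e : {linear _ -> _})).
exists h; split; first by exists (frac_comb e).
move=> i; rewrite -[RHS]gh /= /frac_comb; congr (h _).
rewrite (bigD1 i) //= mxE !eqxx scale1r big1 ?addr0 // => j /negPf ji.
by rewrite mxE ji andbF scale0r.
Qed.

(** Independence statements about a construction on [U] need a test map out of
    it; it is built from the coordinate functions, which exist only with values
    in the localized ring. *)
Lemma local_basis_coord (A : comPzRingType) (f : A) (U : lmodType A) n (e : 'I_n -> U) :
  local_basis f e ->
  exists c : 'I_n -> {linear U -> restr_scal (loc_ring f)^o (loc_map f)},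
    forall i j, c i (e j) = (i == j)%:R.
Proof.
move=> /local_basis_iso[h [_ he]].
pose c i (u : U) : restr_scal (loc_ring f)^o (loc_map f) := h (frac f u 0) 0 i.
have cl i : linear (c i).
  move=> a u v; rewrite /c fracD -[a *: u]/(a *: u) -[0%N]/(0 + 0)%N -fracZ linearP mxE.
  by rewrite mxE.
exists (fun i => HB.pack_for {linear U -> restr_scal (loc_ring f)^o (loc_map f)}
   (c i) (GRing.isLinear.Build _ _ _ _ _ (cl i))) => i j /=.
by rewrite /c he mxE eqxx.
Qed.

Lemma locally_freeP (A : comPzRingType) (U : lmodType A) n :
  locally_free n U <-> exists2 s : seq A, covers s &
    forall f, f \in s -> exists e : 'I_n -> U, local_basis f e.
Proof.
split; last first.
  case=> s sc sP; exists s; split=> // f /sP[e /local_basis_iso[h [hb _]]].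
  by exists h.
case=> s [sc sP]; exists s => // f /sP[h /linear_inv[g [hg gh]]].
have /choice[p pP] : forall i : 'I_n, exists p : U * nat, g (delta_mx 0 i) = frac f p.1 p.2.
  by move=> i; elim/frac_ind: (g _) => u m; exists (u, m).
pose e i := (p i).1; exists e.
(* Powers of [f] are units of the localized ring, so that the numerators of a
   basis are again a basis. *)
have he i : h (frac f (e i) 0) = frac_ring f (f ^+ (p i).2) 0 *: delta_mx 0 i.
  rewrite -[in RHS](gh (delta_mx 0 i)) pP -linearZ /= fracZ add0n.
  by congr (h _); rewrite -[LHS](frac_mul f (p i).2) addn0.
have hsum a i : h (frac f (\sum_i a i *: e i) 0) 0 i = loc_map f (a i * f ^+ (p i).2).
  rewrite frac_sum linear_sum summxE (bigD1 i) //= big1 ?addr0 => [|j /negPf ji];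
    rewrite -[in frac _ _ 0%N](addn0 0%N) -fracZ linearZ /= he !mxE !eqxx /=.
    by rewrite mulr1 [LHS]loc_mulE.
  by rewrite eq_sym ji !mulr0.
split.
  move=> u; have [b [N bE]] := frac_common (fun i => h (frac f u 0) 0 i).
  pose P := (\sum_i (p i).2)%N.
  have Pi i : ((p i).2 <= P)%N by rewrite /P (bigD1 i) //= leq_addr.
  pose a i := f ^+ (P - (p i).2) * b i.
  suff : frac f (f ^+ (N + P) *: u) 0 = frac f (\sum_i a i *: e i) 0.
    case/fracP => q; rewrite addn0 => E; exists (q + (N + P))%N, (fun i => f ^+ q * a i).
    rewrite exprD -scalerA E scaler_sumr.
    by apply: eq_bigr => i _; rewrite scalerA.
  apply: (can_inj hg); apply/rowP => i; rewrite hsum.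
  rewrite -[in frac _ _ 0%N](addn0 0%N) -fracZ linearZ !mxE bE.
  rewrite [LHS]loc_mulE add0n /a mulrAC -exprD subnK //.
  apply/(fracP f (_ : A^o)); exists 0%N.
  by rewrite addn0 expr0 scale1r add0n exprD -mulrA.
move=> a a0 i; have := hsum a i; rewrite a0.
have -> : frac f 0 0 = 0 :> loc f U by apply/frac_eq0; exists 0%N; rewrite scaler0.
rewrite linear0 mxE => /esym/frac_ring_eq0[N aN].
by exists (N + (p i).2)%N; rewrite exprD -mulrA [_ * a i]mulrC.
Qed.

(** * Bilinear maps, generators, and base change of exterior squares *)

Section Bilinear.
Variables (R : comPzRingType) (M N L : lmodType R) (b : M * N -> L).
Hypothesis b_bil : bilinear_map b.

Lemma bilDl x y z : b (x + y, z) = b (x, z) + b (y, z).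
Proof. by have := b_bil.2 z 1 x y; rewrite !scale1r. Qed.
Lemma bilDr x y z : b (x, y + z) = b (x, y) + b (x, z).
Proof. by have := b_bil.1 x 1 y z; rewrite !scale1r. Qed.
Lemma bilZl a x z : b (a *: x, z) = a *: b (x, z).
Proof. exact: (GRing.scalable_linear (b_bil.2 z)). Qed.
Lemma bilZr a x z : b (x, a *: z) = a *: b (x, z).
Proof. exact: (GRing.scalable_linear (b_bil.1 x)). Qed.
Lemma bil0l z : b (0, z) = 0.
Proof. by rewrite -(scale0r 0) bilZl scale0r. Qed.
Lemma bil0r x : b (x, 0) = 0.
Proof. by rewrite -(scale0r 0) bilZr scale0r. Qed.
Lemma bilNl x z : b (- x, z) = - b (x, z).
Proof. by rewrite -scaleN1r bilZl scaleN1r. Qed.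
Lemma bilNr x z : b (x, - z) = - b (x, z).
Proof. by rewrite -scaleN1r bilZr scaleN1r. Qed.
Lemma bilBl x y z : b (x - y, z) = b (x, z) - b (y, z).
Proof. by rewrite bilDl bilNl. Qed.
Lemma bilBr x y z : b (x, y - z) = b (x, y) - b (x, z).
Proof. by rewrite bilDr bilNr. Qed.
Lemma bil_suml I (s : seq I) (F : I -> M) z :
  b (\sum_(i <- s) F i, z) = \sum_(i <- s) b (F i, z).
Proof. by apply: (big_morph (fun x => b (x, z)) _ (bil0l z)) => x y; exact: bilDl. Qed.

End Bilinear.

Lemma altC (R : comPzRingType) (M L : lmodType R) (b : M * M -> L) (bP : alternating_map b) x y :
  b (y, x) = - b (x, y).
Proof.
have [bil alt] := bP; apply/eqP; rewrite -addr_eq0; apply/eqP.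
have := alt (x + y); rewrite (bilDl bil) !(bilDr bil) !alt add0r addr0 addrC.
by [].
Qed.

Lemma pres_ind (R : comPzRingType) (X : choiceType) (P : forall M : lmodType R, (X -> M) -> Prop)
    (Q : presented P -> Prop) :
  Q 0 -> (forall x y, Q x -> Q y -> Q (x + y)) ->
  (forall a x, Q (a *: pres_gen P x)) -> forall x, Q x.
Proof. by move=> Q0 QD Qg x; have [s ->] := pres_span x; apply: big_ind. Qed.

Section Generators.
Variables (R : comPzRingType).

Lemma ext2_ind (M : lmodType R) (Q : ext2 M -> Prop) :
  Q 0 -> (forall x y, Q x -> Q y -> Q (x + y)) ->
  (forall x y, Q (wedge x y)) -> forall x, Q x.
Proof.
move=> Q0 QD Qw; apply: pres_ind => // a [x y].
have -> : a *: pres_gen (@alternating_map R M) (x, y) = wedge (a *: x) y.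
  exact/esym/(bilZl (wedge_alternating M).1).
exact: Qw.
Qed.

Variables (S : comPzRingType) (iota : {rmorphism R -> S}).

Lemma bc_ind (M : lmodType R) (Q : base_change iota M -> Prop) :
  Q 0 -> (forall x y, Q x -> Q y -> Q (x + y)) ->
  (forall s m, Q (bc_tens iota s m)) -> forall x, Q x.
Proof.
move=> Q0 QD Qt; apply: pres_ind => // a [s m].
have -> : a *: pres_gen (@balanced_map R S iota M) (s, m) = bc_tens iota (a * s) m.
  exact/esym/bc_tensZl.
exact: Qt.
Qed.

Lemma bc_eq (M : lmodType R) (N : lmodType S) (f g : {linear base_change iota M -> N}) :
  (forall m, f (bc_tens iota 1 m) = g (bc_tens iota 1 m)) -> f =1 g.
Proof.
move=> fg z; elim/bc_ind: z => [|x y fx fy|s m]; first by rewrite !linear0.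
  by rewrite !linearD fx fy.
by rewrite -[s]mulr1 bc_tensZl !linearZ /= fg.
Qed.

End Generators.

Lemma alt_lift (R : comPzRingType) (M N : lmodType R) (b : M * M -> N) :
  alternating_map b -> exists h : {linear ext2 M -> N}, forall x y, h (wedge x y) = b (x, y).
Proof. by move=> bP; exists (pres_lift bP) => x y; apply: pres_lift_gen. Qed.

Section Ext2BaseChangeInverse.
Variables (R S : comPzRingType) (iota : {rmorphism R -> S}) (M : lmodType R).

Notation SM := (base_change iota M).
Notation SE := (base_change iota (ext2 M)).

Fact half_wedge_linear m :
  linear ((fun m' => bc_tens iota 1 (wedge m m')) : M -> restr_scal SE iota).
Proof.
move=> a x y; rewrite (bilDr (wedge_alternating M).1) (bilZr (wedge_alternating M).1).
by rewrite bc_tensDr bc_tensZr.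
Qed.

Definition half_wedge m : {linear SM -> SE} := bc_lift (half_wedge_linear m).

Lemma half_wedgeE m s m' : half_wedge m (bc_tens iota s m') = bc_tens iota s (wedge m m').
Proof. by rewrite bc_liftE -bc_tensZl mulr1. Qed.

Fact half_wedge_linearl y : linear (half_wedge^~ y : M -> restr_scal SE iota).
Proof.
move=> a m m'; elim/bc_ind: y => [|x y|s y].
- by rewrite !linear0 addr0.
- by rewrite !linearD => -> ->; rewrite addrACA.
rewrite !half_wedgeE (bilDl (wedge_alternating M).1) (bilZl (wedge_alternating M).1).
by rewrite bc_tensDr bc_tensZr.
Qed.

(** The inverse of [ext2_bc] on decomposable elements: it sends
    (s (x) m, s' (x) m') to s s' (x) (m /\ m'). It is extended linearly in one
    argument at a time. *)
Definition bc_wedge (p : SM * SM) : SE := bc_lift (half_wedge_linearl p.2) p.1.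

Lemma bc_wedgeE s m s' m' :
  bc_wedge (bc_tens iota s m, bc_tens iota s' m') = bc_tens iota (s * s') (wedge m m').
Proof. by rewrite /bc_wedge bc_liftE half_wedgeE bc_tensZl. Qed.

Lemma bc_wedge_bil : bilinear_map bc_wedge.
Proof.
have E x y : bc_wedge (x, y) = bc_lift (half_wedge_linearl y) x by [].
split=> [x|y] a u v; rewrite !E; last by rewrite linearP.
elim/bc_ind: x => [|x y|s m]; first by rewrite !linear0 addr0.
  by rewrite !linearD => -> ->; rewrite addrACA.
by rewrite !bc_liftE linearP scalerDr !scalerA mulrC.
Qed.

Lemma bc_wedge_alt : alternating_map bc_wedge.
Proof.
have bil := bc_wedge_bil; split=> //.
have [_ alt] := wedge_alternating M.
have anti x y : bc_wedge (y, x) = - bc_wedge (x, y).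
  elim/bc_ind: x => [|x x'|s m]; first by rewrite bil0l // bil0r // oppr0.
    by rewrite (bilDl bil) (bilDr bil) => -> ->; rewrite opprD.
  elim/bc_ind: y => [|y y'|s' m']; first by rewrite bil0l // bil0r // oppr0.
    by rewrite (bilDl bil) (bilDr bil) => -> ->; rewrite opprD.
  rewrite !bc_wedgeE wedgeC mulrC -scaleN1r bc_tensZr rmorphN1 scaleN1r.
  by [].
elim/bc_ind => [|x y|s m]; first by rewrite bil0l.
  by rewrite (bilDl bil) !(bilDr bil) (anti x y) => -> ->; rewrite add0r addr0 subrr.
by rewrite bc_wedgeE; have /= -> := alt m; rewrite -(scale0r 0) bc_tensZr rmorph0 scale0r.
Qed.

Lemma ext2_bc_bij : bijective (ext2_bc iota M).
Proof.
have [g gE] := alt_lift bc_wedge_alt.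
exists g; first elim/bc_ind => [|x y|s m]; first by rewrite !linear0.
- by rewrite !linearD => -> ->.
- elim/ext2_ind: m => [|x y|x y]; first by rewrite -(scale0r 0) bc_tensZr rmorph0 scale0r !linear0.
    by rewrite bc_tensDr !linearD => -> ->.
  rewrite ext2_bcE linearZ /= gE bc_wedgeE mulr1.
  by rewrite -bc_tensZl mulr1.
elim/ext2_ind => [|x y|x y]; first by rewrite !linear0.
  by rewrite !linearD => -> ->.
have W := (wedge_alternating (base_change iota M)).1.
rewrite gE; elim/bc_ind: x => [|x z|s m].
- by rewrite (bil0l bc_wedge_bil) linear0; apply/esym/(bil0l W).
- rewrite (bilDl bc_wedge_bil) linearD => -> ->; exact/esym/(bilDl W).
elim/bc_ind: y => [|x z|s' m'].
- by rewrite (bil0r bc_wedge_bil) linear0; apply/esym/(bil0r W).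
- rewrite (bilDr bc_wedge_bil) linearD => -> ->; exact/esym/(bilDr W).
rewrite bc_wedgeE ext2_bcE -[s]mulr1 -[s']mulr1 !bc_tensZl !mulr1 -scalerA.
by rewrite -(bilZr W) -(bilZl W).
Qed.

End Ext2BaseChangeInverse.

Lemma alt_det (A : comPzRingType) (U L : lmodType A) (b : U * U -> L) :
  alternating_map b -> forall e1 e2 x1 x2 y1 y2,
  b (x1 *: e1 + x2 *: e2, y1 *: e1 + y2 *: e2) = (x1 * y2 - x2 * y1) *: b (e1, e2).
Proof.
move=> bP e1 e2 x1 x2 y1 y2; have [bil alt] := bP.
rewrite (bilDl bil) !(bilDr bil) !(bilZl bil) !(bilZr bil) !alt !scaler0 add0r addr0.
by rewrite (altC bP e1 e2) !scalerN !scalerA scalerBl.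
Qed.

(** * Modules of rank one and two *)

Section LocalFrames.
Variables (A : comPzRingType) (f : A).

(** [local_gen] and [local_pair] are [local_basis] for one and two vectors, with
    the coefficients written out. *)
Definition local_gen (U : lmodType A) (e : U) : Prop :=
  (forall u, exists N a, f ^+ N *: u = a *: e) /\
  (forall a, a *: e = 0 -> exists N, f ^+ N * a = 0).

Definition local_pair (U : lmodType A) (e1 e2 : U) : Prop :=
  (forall u, exists N a b, f ^+ N *: u = a *: e1 + b *: e2) /\
  (forall a b, a *: e1 + b *: e2 = 0 -> exists N, f ^+ N * a = 0 /\ f ^+ N * b = 0).

Variable U : lmodType A.

Lemma local_gen_basis (e : 'I_1 -> U) : local_basis f e <-> local_gen (e ord0).
Proof.
split=> -[eS eI]; split.
- by move=> u; have [N [a ua]] := eS u; exists N, (a ord0); rewrite ua big_ord1.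
- move=> a a0; have [|N aN] := eI (fun=> a) _ ord0; first by rewrite big_ord1.
  by exists N.
- by move=> u; have [N [a ua]] := eS u; exists N, (fun=> a); rewrite big_ord1.
- by move=> a; rewrite big_ord1 => /eI a0 i; rewrite (ord1 i).
Qed.

Lemma local_pair_basis (e : 'I_2 -> U) :
  local_basis f e <-> local_pair (e ord0) (e ord_max).
Proof.
have E (a : 'I_2 -> A) : \sum_i a i *: e i = a ord0 *: e ord0 + a ord_max *: e ord_max.
  by rewrite big_ord_recl big_ord1; congr (_ + a _ *: e _); apply: val_inj.
pose h (a b : A) (i : 'I_2) := if i == ord0 then a else b.
split=> -[eS eI]; split.
- by move=> u; have [N [a ua]] := eS u; exists N, (a ord0), (a ord_max); rewrite ua E.
- move=> a b ab0; have abP : \sum_i h a b i *: e i = 0 by rewrite E.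
  have [N aN] := eI _ abP ord0; have [N' bN] := eI _ abP ord_max.
  exists (N' + N)%N; split; first by rewrite exprD -mulrA [_ * a]aN mulr0.
  by rewrite addnC exprD -mulrA [_ * b]bN mulr0.
- by move=> u; have [N [a [b ua]]] := eS u; exists N, (h a b); rewrite E.
- move=> a; rewrite E => /eI[N [a0 b0]] i; exists N.
  have [->//|i0] := eqVneq i ord0; suff -> : i = ord_max by [].
  by apply/val_inj; case: i i0 => [[|[|]]].
Qed.

Lemma local_pair_coord (e1 e2 : U) : local_pair e1 e2 ->
  exists c1 c2 : {linear U -> restr_scal (loc_ring f)^o (loc_map f)},
    [/\ c1 e1 = 1, c1 e2 = 0, c2 e1 = 0 & c2 e2 = 1].
Proof.
move=> eP; pose e (i : 'I_2) := if i == ord0 then e1 else e2.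
have /local_basis_coord[c cE] : local_basis f e by apply/local_pair_basis.
exists (c ord0), (c ord_max).
split; [exact: (cE ord0 ord0) | exact: (cE ord0 ord_max) |
        exact: (cE ord_max ord0) | exact: (cE ord_max ord_max)].
Qed.

Lemma local_gen_coord (e : U) : local_gen e ->
  exists c : {linear U -> restr_scal (loc_ring f)^o (loc_map f)}, c e = 1.
Proof.
move=> eP.
have /local_basis_coord[c cE] : local_basis f (fun _ : 'I_1 => e) by apply/local_gen_basis.
by exists (c ord0); rewrite (cE ord0 ord0).
Qed.

End LocalFrames.

Lemma scale_pow_trans (A : comPzRingType) (U : lmodType A) (f : A) M N (u v : U) :
  f ^+ M *: u = v -> f ^+ (N + M) *: u = f ^+ N *: v.
Proof. by move=> <-; rewrite scalerA exprD. Qed.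

(** The determinant in local coordinates detects the multiples of
    [wedge e1 e2]. *)
Lemma local_gen_wedge (A : comPzRingType) (f : A) (U : lmodType A) (e1 e2 : U) :
  local_pair f e1 e2 -> local_gen f (wedge e1 e2).
Proof.
move=> eP; have [eS eI] := eP; have W := wedge_alternating U; have Wb := W.1.
split.
  elim/ext2_ind => [|x y [N [a xa]] [M [b yb]]|x y].
  - by exists 0%N, 0; rewrite scaler0 scale0r.
  - exists (N + M)%N, (f ^+ M * a + f ^+ N * b).
    rewrite scalerDl -!scalerA -xa -yb scalerDr !scalerA -!exprD.
    by rewrite [(M + N)%N]addnC.
  have [N [a [b xE]]] := eS x; have [M [c [d yE]]] := eS y.
  exists (N + M)%N, (a * d - b * c); rewrite -(alt_det W) /= -xE -yE.
  by rewrite exprD -scalerA -(bilZr Wb) -(bilZl Wb).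
move=> a; have [c1 [c2 [c11 c12 c21 c22]]] := local_pair_coord eP.
pose b (p : U * U) : restr_scal (loc_ring f)^o (loc_map f) :=
  (c1 p.1 : loc_ring f) * (c2 p.2 : loc_ring f) -
  (c1 p.2 : loc_ring f) * (c2 p.1 : loc_ring f).
have bP : alternating_map b.
  split; last by move=> m; rewrite /b /= subrr.
  have sc c (x : restr_scal (loc_ring f)^o (loc_map f)) :
    c *: x = loc_map f c * (x : loc_ring f) by [].
  split=> [x|y] r u v; rewrite /b !linearP /= !sc /=; ring.
have [h hE] := alt_lift bP.
move=> /(congr1 h); rewrite linearZ linear0 hE /b /= c11 c22 c12 mul0r subr0 mulr1.
move=> a0; apply/(frac_ring_eq0 f a 0).
rewrite -[LHS]mulr1; exact: a0.
Qed.

(** Wedging [u] with [e2] and [e1] reads off its two coordinates. *)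
Lemma wedge_nondeg (A : comPzRingType) (f : A) (U : lmodType A) (e1 e2 u : U) :
  local_pair f e1 e2 -> (forall v, wedge u v = 0) -> exists N, f ^+ N *: u = 0.
Proof.
move=> eP u0; have [eS eI] := eP; have [_ wI] := local_gen_wedge eP.
have W := wedge_alternating U.
have [N [a [b uE]]] := eS u.
have uw c d : (a * d - b * c) *: wedge e1 e2 = 0.
  by rewrite -(alt_det W) /= -uE (bilZl W.1) /= u0 scaler0.
have [M aM] : exists M, f ^+ M * a = 0.
  by apply: wI; have := uw 0 1; rewrite mulr1 mulr0 subr0.
have [M' bM] : exists M, f ^+ M * b = 0.
  by apply: wI; have := uw (-1) 0; rewrite mulr0 mulrN1 opprK add0r.
exists ((M + M') + N)%N; rewrite (scale_pow_trans _ uE) scalerDr !scalerA.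
have -> : f ^+ (M + M') * a = 0 by rewrite addnC exprD -mulrA aM mulr0.
by rewrite exprD -mulrA bM mulr0 !scale0r addr0.
Qed.

(** The product of the coordinates with respect to [e] is a bilinear test map. *)
Lemma tens_cancel (A : comPzRingType) (f : A) (L : lmodType A) (e v : L) :
  local_gen f e -> tens e v = 0 -> exists N, f ^+ N *: v = 0.
Proof.
move=> eP ev0; have [eS eI] := eP; have [c ce] := local_gen_coord eP.
pose b (p : L * L) : restr_scal (loc_ring f)^o (loc_map f) :=
  (c p.1 : loc_ring f) * (c p.2 : loc_ring f).
have bP : bilinear_map b.
  have sc r (x : restr_scal (loc_ring f)^o (loc_map f)) :
    r *: x = loc_map f r * (x : loc_ring f) by [].
  split=> [x|y] r u w; rewrite /b !linearP /= !sc /=; ring.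
have [N [a vE]] := eS v.
have := pres_lift_gen bP (e, v); rewrite -/(tens e v) ev0 linear0 /b /= ce => cv.
have : c (f ^+ N *: v) = 0.
  rewrite linearZ /= [X in _ *: X](_ : _ = 0) ?scaler0 //.
  by rewrite -[LHS]mul1r.
rewrite vE linearZ /= ce => a0.
have [M aM] : exists M, f ^+ M * a = 0.
  by apply/(frac_ring_eq0 f a 0); rewrite -[LHS]mulr1; exact: a0.
by exists (M + N)%N; rewrite (scale_pow_trans _ vE) scalerA aM scale0r.
Qed.

Lemma rank1P (A : comPzRingType) (L : lmodType A) :
  locally_free 1 L <-> exists2 s, covers s & forall f, f \in s -> exists e : L, local_gen f e.
Proof.
rewrite locally_freeP; split=> -[s sc sP]; exists s => // f /sP[e eP].
  by exists (e ord0); apply/local_gen_basis.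
by exists (fun=> e); apply/local_gen_basis.
Qed.

Lemma rank2P (A : comPzRingType) (U : lmodType A) :
  locally_free 2 U <-> exists2 s, covers s &
    forall f, f \in s -> exists e1 e2 : U, local_pair f e1 e2.
Proof.
rewrite locally_freeP; split=> -[s sc sP]; exists s => // f /sP[e1].
  by move/local_pair_basis; exists (e1 ord0), (e1 ord_max).
case=> e2 eP; exists (fun i => if i == ord0 then e1 else e2).
exact/local_pair_basis.
Qed.

Lemma rank1_tensC (A : comPzRingType) (L : lmodType A) :
  locally_free 1 L -> forall u v : L, tens u v = tens v u.
Proof.
move=> /rank1P[s sc sP] u v; apply/eqP; rewrite -subr_eq0; apply/eqP.
apply: (eq0_cover sc) => f /sP[e [eS _]].
have [N [a uE]] := eS u; have [M [b vE]] := eS v.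
have T := tens_bilinear L L.
exists (N + M)%N; rewrite scalerBr.
have -> : f ^+ (N + M) *: tens u v = tens (f ^+ N *: u) (f ^+ M *: v).
  by rewrite exprD -scalerA -(bilZr T) -(bilZl T).
have -> : f ^+ (N + M) *: tens v u = tens (f ^+ M *: v) (f ^+ N *: u).
  by rewrite addnC exprD -scalerA -(bilZr T) -(bilZl T).
rewrite uE vE (bilZl T a e (b *: e)) (bilZr T b e e) (bilZl T b e (a *: e)) (bilZr T a e e) /=.
by rewrite !scalerA mulrC subrr.
Qed.

Lemma rank2_ext2 (A : comPzRingType) (U : lmodType A) :
  locally_free 2 U -> locally_free 1 (ext2 U).
Proof.
move=> /rank2P[s sc sP]; apply/rank1P; exists s => // f /sP[e1 [e2 /local_gen_wedge eP]].
by exists (wedge e1 e2).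
Qed.

Lemma rank2_nondeg (A : comPzRingType) (U : lmodType A) :
  locally_free 2 U -> forall u : U, (forall v, wedge u v = 0) -> u = 0.
Proof.
move=> /rank2P[s sc sP] u u0; apply: (eq0_cover sc) => f /sP[e1 [e2 eP]].
exact: wedge_nondeg eP u0.
Qed.

(** * The Plücker form *)

Section PluckerForm.
Variables (A : comPzRingType) (M L : lmodType A) (b : M * M -> L).
Hypothesis bP : alternating_map b.

(** At the basis vectors of indices i, j, k, l this is the left-hand side of the
    Plücker equation. *)
Definition plucker_form (x y z w : M) : tensor L L :=
  tens (b (x, y)) (b (z, w)) - tens (b (x, z)) (b (y, w)) + tens (b (x, w)) (b (y, z)).

Lemma plucker_form_linear x y z : linear (plucker_form x y z).
Proof.
have T := tens_bilinear L L; have B := bP.1.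
move=> a u v; rewrite /plucker_form !(bilDr B) !(bilZr B).
have D1 p q r : tens p (q + r) = tens p q + tens p r := bilDr T p q r.
have D2 p q r : tens (p + q) r = tens p r + tens q r := bilDl T p q r.
have Z1 p q r : tens p (q *: r) = q *: tens p r := bilZr T q p r.
have Z2 p q r : tens (q *: p) r = q *: tens p r := bilZl T q p r.
rewrite !D1 D2 !Z1 Z2 scalerDr scalerBr.
by rewrite opprD [X in X + _ = _]addrACA [LHS]addrACA.
Qed.

Lemma plucker_form_swap34 x y z w : plucker_form x y w z = - plucker_form x y z w.
Proof.
have T := tens_bilinear L L.
rewrite /plucker_form (altC bP z w).
have -> : tens (b (x, y)) (- b (z, w)) = - tens (b (x, y)) (b (z, w)) := bilNr T _ _.
by rewrite !opprD opprK addrAC.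
Qed.

Lemma plucker_form_swap23 x y z w : plucker_form x z y w = - plucker_form x y z w.
Proof.
have T := tens_bilinear L L.
rewrite /plucker_form (altC bP y z).
have -> : tens (b (x, w)) (- b (y, z)) = - tens (b (x, w)) (b (y, z)) := bilNr T _ _.
by rewrite !opprD opprK [in RHS](addrC (- _)).
Qed.

Hypothesis tensC : forall u v : L, tens u v = tens v u.

Lemma plucker_form_swap12 x y z w : plucker_form y x z w = - plucker_form x y z w.
Proof.
have T := tens_bilinear L L.
rewrite /plucker_form (altC bP x y).
have -> : tens (- b (x, y)) (b (z, w)) = - tens (b (x, y)) (b (z, w)) := bilNl T _ _.
rewrite (tensC (b (y, z))) (tensC (b (y, w))).
by rewrite !opprD opprK addrAC.
Qed.

Lemma plucker_form_xx z w x : plucker_form x x z w = 0.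
Proof.
have T := tens_bilinear L L.
rewrite /plucker_form bP.2 (tensC (b (x, z))).
have -> : tens 0 (b (z, w)) = 0 := bil0l T _.
by rewrite sub0r addNr.
Qed.

(** The adjacent transpositions change the sign of the form, so its vanishing
    may be tested with the arguments in any order. *)
Let opp0 (u v : tensor L L) : u = - v -> u = 0 -> v = 0.
Proof. by move=> -> /eqP; rewrite oppr_eq0 => /eqP. Qed.
Let s12 x y z w h := opp0 (plucker_form_swap12 x y z w) h.
Let s23 x y z w h := opp0 (plucker_form_swap23 x y z w) h.
Let s34 x y z w h := opp0 (plucker_form_swap34 x y z w) h.

Section Span.
Variables (I : Type) (e : I -> M).
Hypothesis e_span : forall x : M, exists s : seq (A * I), x = \sum_(p <- s) p.1 *: e p.2.

(** The form is linear in its last argument, and the transpositions bring each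
    argument in turn to the last place. *)
Lemma plucker_form_span :
  (forall i j k l, plucker_form (e i) (e j) (e k) (e l) = 0) ->
  forall x y z w, plucker_form x y z w = 0.
Proof.
have ext x y z : (forall i, plucker_form x y z (e i) = 0) ->
    forall w, plucker_form x y z w = 0.
  move=> xyz w; have [s ->] := e_span w.
  pose h : {linear M -> tensor L L} := HB.pack (plucker_form x y z)
    (GRing.isLinear.Build _ _ _ _ _ (plucker_form_linear x y z)).
  rewrite -[plucker_form x y z]/(h : M -> _) linear_sum big1 // => p _.
  by rewrite linearZ /= xyz scaler0.
move=> H.
have H4 i j k w : plucker_form (e i) (e j) (e k) w = 0 by apply: ext.
have H3 i j z w : plucker_form (e i) (e j) z w = 0.
  by apply: ext => l; apply/s34.
have H2 i y z w : plucker_form (e i) y z w = 0.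
  by apply: ext => l; apply/s34/s23.
by move=> x y z w; apply: ext => l; apply/s34/s23/s12.
Qed.

End Span.

(** An alternating form vanishes as soon as it does on increasing tuples; the
    nested cases sort the indices by moving the least one to the front. *)
Lemma plucker_form_sorted (e : int -> M) :
  (forall i j k l : int, (i < j)%R -> (j < k)%R -> (k < l)%R ->
    plucker_form (e i) (e j) (e k) (e l) = 0) ->
  forall i j k l, plucker_form (e i) (e j) (e k) (e l) = 0.
Proof.
have P12 x y w : plucker_form x x y w = 0 by apply: plucker_form_xx.
have P23 x y w : plucker_form x y y w = 0.
  by apply/s12/s23/P12.
have P34 x y z : plucker_form x y z z = 0.
  by apply/s23/s34/P23.
move=> H.
have H1 i j k l : (i <= j -> j <= k -> k <= l -> plucker_form (e i) (e j) (e k) (e l) = 0)%R.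
  rewrite le_eqVlt => /predU1P[->|ij]; first by [].
  rewrite le_eqVlt => /predU1P[->|jk]; first by [].
  rewrite le_eqVlt => /predU1P[->|kl]; first by [].
  exact: H.
have H2 i j k l : (i <= j -> j <= k -> j <= l -> plucker_form (e i) (e j) (e k) (e l) = 0)%R.
  move=> ij jk jl; have [kl|/ltW lk] := leP k l; first exact: H1.
  by apply/s34/H1.
have H3 i j k l : (i <= j -> i <= k -> i <= l -> plucker_form (e i) (e j) (e k) (e l) = 0)%R.
  move=> ij ik il.
  have [jk|/ltW kj] := leP j k.
    have [jl|/ltW lj] := leP j l; first exact: H2.
    by apply/s34/s23/H2 => //; apply: le_trans jk.
  have [kl|/ltW lk] := leP k l; first by apply/s23/H2.
  by apply/s34/s23/H2 => //; apply: le_trans kj.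
have H4 i j k l : (i <= j -> i <= k -> plucker_form (e i) (e j) (e k) (e l) = 0)%R.
  move=> ij ik; have [il|/ltW li] := leP i l; first exact: H3.
  by apply/s34/s23/s12/H3 => //; apply: le_trans li _.
have H5 i j k l : (i <= j -> plucker_form (e i) (e j) (e k) (e l) = 0)%R.
  move=> ij; have [ik|/ltW ki] := leP i k; first exact: H4.
  by apply/s23/s12/H4 => //; apply: le_trans ki _.
move=> i j k l; have [ij|/ltW ji] := leP i j; first exact: H5.
exact/s12/H5.
Qed.

End PluckerForm.

Section Rank2Plucker.
Variables (A : comPzRingType).

Lemma plucker_formZ (M L : lmodType A) (b : M * M -> L) (bP : alternating_map b) p q r s x y z w :
  plucker_form b (p *: x) (q *: y) (r *: z) (s *: w) = (p * q * r * s) *: plucker_form b x y z w.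
Proof.
have T := tens_bilinear L L; have B := bP.1.
rewrite /plucker_form !(bilZl B) !(bilZr B).
have Z1 p' q' r' : tens p' (q' *: r') = q' *: tens p' r' := bilZr T q' p' r'.
have Z2 p' q' r' : tens (q' *: p') r' = q' *: tens p' r' := bilZl T q' p' r'.
rewrite !Z1 !Z2 !scalerA scalerDr scalerBr.
by congr (_ *: _ - _ *: _ + _ *: _); ring.
Qed.

(** In a plane all four vectors are combinations of two, and the form becomes
    the identity between the 2 x 2 minors of a 2 x 4 matrix. *)
Lemma rank2_plucker (U : lmodType A) : locally_free 2 U ->
  forall x y z w : U, plucker_form (fun p => wedge p.1 p.2) x y z w = 0.
Proof.
move=> /rank2P[s sc sP] x y z w; apply: (eq0_cover sc) => f /sP[e1 [e2 [eS _]]].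
have W := wedge_alternating U.
have T := tens_bilinear (ext2 U) (ext2 U).
have Z1 p' q' r' : tens p' (q' *: r') = q' *: tens p' r' := bilZr T q' p' r'.
have Z2 p' q' r' : tens (q' *: p') r' = q' *: tens p' r' := bilZl T q' p' r'.
have [N1 [a1 [b1 E1]]] := eS x; have [N2 [a2 [b2 E2]]] := eS y.
have [N3 [a3 [b3 E3]]] := eS z; have [N4 [a4 [b4 E4]]] := eS w.
exists (N1 + N2 + N3 + N4)%N; rewrite !exprD -(plucker_formZ W) E1 E2 E3 E4.
rewrite /plucker_form !(alt_det W) !Z1 !Z2 !scalerA -scalerBl -scalerDl.
rewrite [X in X *: _](_ : _ = 0) ?scale0r //; ring.
Qed.

End Rank2Plucker.

(** * Recovering the plane from its Plücker coordinates *)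

Section Construction.
Variables (A : comPzRingType) (M L : lmodType A) (D : M * M -> L).
Hypotheses (D_alt : alternating_map D) (L_free : locally_free 1 L).
Hypothesis D_gen : forall u, exists s : seq (M * M), u = \sum_(p <- s) D p.
Hypothesis D_plucker : forall x y z w, plucker_form D x y z w = 0.

Definition kills (N : lmodType A) (g : M -> N) : Prop :=
  linear g /\ forall x, (forall y, D (x, y) = 0) -> g x = 0.

(** The quotient of [M] by the radical of [D], presented by its universal
    property. *)
Definition quo : lmodType A := presented kills.
Definition cl (x : M) : quo := pres_gen kills x.

Fact cl_linear : linear cl.
Proof.
by move=> a x y; apply: presP => N g Pg; rewrite linearP !pres_lift_gen; apply: Pg.1.
Qed.

HB.instance Definition _ := GRing.isLinear.Build A M quo *:%R cl cl_linear.

Lemma cl_surj u : exists x, cl x = u.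
Proof.
elim/pres_ind: u => [|x y [x' <-] [y' <-]|a x]; first by exists 0; rewrite linear0.
  by exists (x' + y'); rewrite linearD.
by exists (a *: x); rewrite linearZ.
Qed.

Lemma cl_eq0 x : cl x = 0 <-> forall y, D (x, y) = 0.
Proof.
split=> [x0 y|x0]; last first.
  by apply: presP => N g Pg; rewrite linear0 pres_lift_gen; apply: Pg.2.
(* [x |-> D (x, _)] is itself a map that kills exactly the radical. *)
have gP : @kills (M -> L) (fun x y => D (x, y)).
  split=> [a u v|u u0]; apply/funext => z /=; last exact: u0.
  by rewrite (bilDl D_alt.1) (bilZl D_alt.1).
have := pres_lift_gen gP x; rewrite -/(cl x) x0 linear0.
by move=> /(congr1 (fun f => f y)).
Qed.

Lemma D_cl x x' y y' : cl x = cl x' -> cl y = cl y' -> D (x, y) = D (x', y').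
Proof.
move=> xx yy; have B := D_alt.1.
have /cl_eq0 xx0 : cl (x - x') = 0 by rewrite linearB /= xx subrr.
have /cl_eq0 yy0 : cl (y - y') = 0 by rewrite linearB /= yy subrr.
have /eqP := xx0 y; rewrite (bilBl B) subr_eq0 => /eqP ->.
have /eqP := yy0 x'; rewrite (bilBl B) subr_eq0 => /eqP E.
by rewrite (altC D_alt y) E -(altC D_alt y').
Qed.

(** [M] need not be finitely generated, so the formation of the radical could
    fail to commute with localization: each equation D (x, y) = 0 might need its
    own power of the denominator. It does not fail, because finitely many [y]
    suffice. Indeed [L] is locally generated by finitely many values D (v, w),
    and if D (x, v) = D (x, w) = 0 then the Plücker relation of v, w, x, y gives
    D (v, w) (x) D (x, y) = 0. *)
Lemma D_radical_fin : exists T : seq M,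
  forall x, (forall t, t \in T -> D (x, t) = 0) -> forall y, D (x, y) = 0.
Proof.
have /rank1P[s sc sP] := L_free.
have /choice[t tP] : forall f, exists t : seq (M * M), f \in s ->
    local_gen f (\sum_(p <- t) D p).
  move=> f; have [/sP[e eP]|_] := boolP (f \in s); last by exists [::].
  by have [t et] := D_gen e; exists t; rewrite -et.
pose T := flatten [seq flatten [seq [:: p.1; p.2] | p <- t f] | f <- s].
have TP f p : f \in s -> p \in t f -> p.1 \in T /\ p.2 \in T.
  by move=> fs pt; split; apply/flatten_mapP; exists f => //;
    apply/flatten_mapP; exists p; rewrite // !inE eqxx ?orbT.
exists T => x xT y; apply: (eq0_cover sc) => f fs; apply: tens_cancel (tP f fs) _.
have T0 := tens_bilinear L L.
rewrite (bil_suml T0) big_seq big1 // => p /(TP f _ fs)[/xT p1 /xT p2] /=.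
have := D_plucker p.1 p.2 x y; rewrite /plucker_form.
rewrite (altC D_alt x) (altC D_alt x) p1 p2 oppr0 -surjective_pairing.
have -> : tens (0 : L) (D (p.2, y)) = 0 := bil0l T0 _.
have -> : tens (D (p.1, y)) (0 : L) = 0 := bil0r T0 _.
by rewrite subr0 addr0.
Qed.

Lemma uniform_power (f : A) (I : eqType) (P : A -> I -> Prop) (s : seq I) :
  (forall a b i, P a i -> P (b * a) i) ->
  (forall i, exists N, P (f ^+ N) i) -> exists N, forall i, i \in s -> P (f ^+ N) i.
Proof.
move=> PM Pf; elim: s => [|i s [N sN]]; first by exists 0%N.
have [K iK] := Pf i; exists (N + K)%N => j; rewrite inE => /predU1P[->|js].
  by rewrite exprD; apply: PM.
by rewrite addnC exprD; apply/PM/sN.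
Qed.

(** Where D (v, w) generates [L], Cramer's rule
    D (v, w) x = D (x, w) v + D (v, x) w holds modulo the radical: the difference
    [z] of the two sides is orthogonal to [v] and [w], hence to everything by the
    Plücker relation of v, w, z, y. *)
Lemma chart (g : A) v w : local_gen g (D (v, w)) -> local_pair g (cl v) (cl w).
Proof.
move=> gP; have [gS gI] := gP; have B := D_alt.1; have T0 := tens_bilinear L L.
split=> [u|a b].
  have [x <-] := cl_surj u.
  have [N [a aE]] := gS (D (x, w)); have [N' [b bE]] := gS (D (v, x)).
  pose z := g ^+ (N + N') *: x - (g ^+ N' * a) *: v - (g ^+ N * b) *: w.
  have zw : D (z, w) = 0.
    rewrite !(bilBl B) !(bilZl B) D_alt.2 scaler0 subr0.
    by rewrite -scalerA -aE scalerA -exprD addnC subrr.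
  have vz : D (v, z) = 0.
    rewrite !(bilBr B) !(bilZr B) D_alt.2 scaler0 subr0.
    by rewrite -scalerA -bE scalerA -exprD subrr.
  have zy y : exists K, g ^+ K *: D (z, y) = 0.
    apply: (tens_cancel gP); have := D_plucker v w z y; rewrite /plucker_form.
    rewrite vz (altC D_alt z) zw oppr0.
    have -> : tens (0 : L) (D (w, y)) = 0 := bil0l T0 _.
    have -> : tens (D (v, y)) (0 : L) = 0 := bil0r T0 _.
    by rewrite subr0 addr0.
  have [T TP] := D_radical_fin.
  have [|K zK] := @uniform_power g _ (fun a y => a *: D (z, y) = 0) T _ zy.
    by move=> c d y cy; rewrite -scalerA cy scaler0.
  have : cl (g ^+ K *: z) = 0.
    by apply/cl_eq0/TP => t tT; rewrite (bilZl B) zK.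
  rewrite /z !scalerBr !scalerA -exprD !linearB /= !linearZ /=.
  rewrite !scalerN -addrA -opprD => /eqP; rewrite subr_eq0 => /eqP E.
  by exists (K + (N + N'))%N, (g ^+ K * (g ^+ N' * a)), (g ^+ K * (g ^+ N * b)).
rewrite -!linearZ -linearD => /cl_eq0 ab0.
have [N aN] : exists N, g ^+ N * a = 0.
  by apply: gI; have := ab0 w; rewrite (bilDl B) !(bilZl B) D_alt.2 scaler0 addr0.
have [N' bN] : exists N, g ^+ N * b = 0.
  apply: gI; have := ab0 v; rewrite (bilDl B) !(bilZl B) D_alt.2 scaler0 add0r.
  by rewrite (altC D_alt v) scalerN => /eqP; rewrite oppr_eq0 => /eqP.
exists (N' + N)%N; split; first by rewrite exprD -mulrA aN mulr0.
by rewrite addnC exprD -mulrA bN mulr0.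
Qed.

(** Where [f] is invertible [u] is d e up to a unit, so it generates where [d] is
    invertible as well. *)
Lemma local_gen_refine (f d : A) N (e u : L) :
  local_gen f e -> f ^+ N *: u = d *: e -> local_gen (f * d) u.
Proof.
move=> [eS eI] ue; split=> [v|c cu].
  have [n [a va]] := eS v; exists n.+1, (f * d ^+ n * a * f ^+ N).
  rewrite -[RHS]scalerA ue scalerA.
  have -> : (f * d) ^+ n.+1 = f * d ^+ n * d * f ^+ n.
    by rewrite exprMn !exprS; ring.
  by rewrite -scalerA va scalerA; congr (_ *: _); ring.
have [m cm] : exists m, f ^+ m * (c * d) = 0.
  by apply: eI; rewrite -scalerA -ue scalerA mulrC -scalerA cu scaler0.
exists m.+1; have -> : (f * d) ^+ m.+1 * c = f * d ^+ m * (f ^+ m * (c * d)).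
  by rewrite exprMn !exprS; ring.
by rewrite cm mulr0.
Qed.

(** Over the localization at [f], a generator [e] is a sum of values D p, each a
    multiple d_p e of it, so the d_p sum to 1 there and the elements f d_p refine
    the cover. *)
Lemma chart_cover : exists2 s, covers s &
  forall g, g \in s -> exists v w, local_gen g (D (v, w)).
Proof.
have /rank1P[s sc sP] := L_free.
apply/ideal_gen_cover/(ideal_cover (@ideal_genP _ _) sc) => f /sP[e eP].
have [eS eI] := eP; have [t et] := D_gen e.
have [|N tN] := @uniform_power f _ (fun a p => exists d, a *: D p = d *: e) t _
  (fun p => eS (D p)).
  by move=> a b p [d pd]; exists (b * d); rewrite -scalerA pd scalerA.
have /choice[d dP] : forall p, exists d, p \in t -> f ^+ N *: D p = d *: e.
  by move=> p; have [/tN[d]|_] := boolP (p \in t); [exists d | exists 0].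
have [m mE] : exists m, f ^+ m * (f ^+ N - \sum_(p <- t) d p) = 0.
  apply: eI; rewrite scalerBl {1}et scaler_sumr scaler_suml big_seq.
  by rewrite [X in _ - X]big_seq (eq_bigr _ dP) subrr.
have [_ _ QM] := ideal_genP (fun g => exists v w, local_gen g (D (v, w))).
exists (m + N).+1; have -> : f ^+ (m + N).+1 = f ^+ m * \sum_(p <- t) f * d p.
  move/eqP: mE; rewrite mulrBr subr_eq0 -exprD => /eqP E.
  by rewrite exprS E -mulr_sumr; ring.
apply: QM; apply: (ideal_sum (@ideal_genP _ _)).
move=> p pt; exists [:: (1, f * d p)]; last by rewrite big_seq1 mul1r.
move=> q; rewrite inE => /eqP -> /=; exists p.1, p.2; rewrite -surjective_pairing.
exact: local_gen_refine eP (dP p pt).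
Qed.

Lemma quo_free : locally_free 2 quo.
Proof.
apply/rank2P; have [s sc sP] := chart_cover; exists s => // g /sP[v [w gP]].
by exists (cl v), (cl w); apply: chart.
Qed.

(** The map is surjective between modules of rank one, and on a chart it sends
    the generator [wedge (cl v) (cl w)] to the generator [D (v, w)]. *)
Lemma ext2_quo : exists h : {linear ext2 quo -> L},
  bijective h /\ forall x y, h (wedge (cl x) (cl y)) = D (x, y).
Proof.
have /choice[r rK] := cl_surj; have B := D_alt.1.
pose b (p : quo * quo) := D (r p.1, r p.2).
have bP : alternating_map b.
  split; last by move=> u; apply: D_alt.2.
  split=> [u|v] a x y; rewrite /b /=.
    by rewrite -(bilZr B) -(bilDr B); apply: D_cl => //; rewrite linearP /= !rK.
  by rewrite -(bilZl B) -(bilDl B); apply: D_cl => //; rewrite linearP /= !rK.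
have [h hE] := alt_lift bP.
have hcl x y : h (wedge (cl x) (cl y)) = D (x, y) by rewrite hE; apply: D_cl; rewrite rK.
exists h; split=> //.
have hI : injective h.
  apply: raddf_inj => z z0; have [s sc sP] := chart_cover.
  apply: (eq0_cover sc) => g /sP[v [w gP]].
  have [wS _] := local_gen_wedge (chart gP).
  have [N [a za]] := wS z.
  have := congr1 h za; rewrite !linearZ /= z0 scaler0 hcl => /esym/gP.2[K aK].
  by exists (K + N)%N; rewrite (scale_pow_trans _ za) scalerA aK scale0r.
have hS u : exists z, h z = u.
  have [s ->] := D_gen u; exists (\sum_(p <- s) wedge (cl p.1) (cl p.2)).
  by rewrite linear_sum; apply: eq_bigr => p _; rewrite hcl -surjective_pairing.
have /choice[k kP] := hS; exists k => // z; exact: hI.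
Qed.

End Construction.

(** * The topological dual of the formal series *)

Section Dual.
Local Open Scope classical_set_scope.
Variable k : fieldType.

(** Otherwise there are series [w n] vanishing on the first coordinates with
    l (w n) <> 0. They tend to 0 in the product topology, so that [l] takes the
    value 0 on almost all of them. *)
Lemma dual_tail (l : biseries_dual k) : exists n : nat,
  forall v : biseries k, (forall i : int, (`|i|%N < n)%N -> v i = 0) -> l v = 0.
Proof.
have /asboolP[ll lc] : dual_fun l \in @in_dual k by case: l.
have l0 : l 0 = 0.
  by have := ll (-1) 0 0; rewrite addr0 !scaleN1r oppr0 addNr.
apply: contrapT => /forallNP Nl.
have {Nl} /choice[w wP] : forall n, exists v : biseries k,
    (forall i : int, (`|i|%N < n)%N -> v i = 0) /\ l v <> 0.
  by move=> n; have /existsNP[v /not_implyP[v0 lv]] := Nl n; exists v.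
have w0 : (w @ \oo --> (0 : biseries k)).
  apply/cvg_sup => i X.
  rewrite nbhsE => -[B [[C oC <-] C0]] /filterS; apply.
  exists `|i|.+1 => // n /= lin.
  have -> : w n i = (0 : biseries k) i; last exact: C0.
  by rewrite (wP n).1.
have /continuous_discreteP/(_ 0) := lc => /w0[N _ /(_ N (leqnn N)) /=].
by rewrite l0; exact: (wP N).2.
Qed.

Lemma dual_lambda (l : biseries_dual k) : exists s : seq int,
  l = \sum_(i <- s) (l (tpow k i) : k) *: lambda_ k i.
Proof.
have /asboolP[ll _] : dual_fun l \in @in_dual k by case: l.
have [n ln] := dual_tail l.
pose L : {linear biseries k -> k^o} := HB.pack (l : biseries k -> k^o)
  (GRing.isLinear.Build _ _ _ _ _ ll).
pose s : seq int := [seq (m%:Z - n%:Z)%R | m <- iota 0 n.*2].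
have us : uniq s.
  rewrite map_inj_uniq ?iota_uniq // => x y /= /addIr; by case.
have ms i : (`|i|%N < n)%N -> i \in s.
  move=> lin; apply/mapP; exists `|(i + n%:Z)%R|%N; last by rewrite /=; lia.
  by rewrite mem_iota; lia.
exists s; apply/val_inj/funext => v /=.
have -> : \val (\sum_(i <- s) (l (tpow k i) : k) *: lambda_ k i)
    = \sum_(i <- s) (l (tpow k i) : k) *: \val (lambda_ k i).
  by rewrite linear_sum; apply: eq_bigr => i _; rewrite linearZ.
rewrite fct_sumE.
(* [v'] is [v] with its coefficients of index -n <= i < n removed. *)
pose v' : biseries k := v - \sum_(i <- s) (v i : k) *: tpow k i.
have v'E : L v' = 0.
  apply: ln => i lin; rewrite /v'.
  change (v i - (\sum_(j <- s) (v j : k) *: tpow k j) i = 0).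
  rewrite fct_sumE.
  rewrite (eq_bigr (fun j => v j * (i == j)%:R)) // (bigD1_seq i) ?ms //=.
  rewrite eqxx mulr1 big1 ?addr0 ?subrr // => j /negPf ji.
  by rewrite eq_sym ji mulr0.
have -> : l v = L v by [].
move/eqP: v'E; rewrite linearB subr_eq0 => /eqP ->.
rewrite linear_sum; apply: eq_bigr => i _; rewrite linearZ /=.
exact: mulrC.
Qed.

End Dual.

(** * Families and their Plücker images *)

Lemma bc_ext2_eq (R S : comPzRingType) (iota : {rmorphism R -> S}) (M : lmodType R)
    (N : lmodType S) (f g : {linear base_change iota (ext2 M) -> N}) :
  (forall v w, f (bc_tens iota 1 (wedge v w)) = g (bc_tens iota 1 (wedge v w))) -> f =1 g.
Proof.
move=> fg; apply: bc_eq; elim/ext2_ind => [|x y|//].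
  by rewrite -(scale0r 0) bc_tensZr rmorph0 scale0r !linear0.
by rewrite bc_tensDr !linearD => -> ->.
Qed.

Lemma plucker_mapE (k : fieldType) (W : lmodType k) (A : kalg k) (F : qfamily W A) s v w :
  fam_map (plucker F) (bc_tens _ s (wedge v w)) =
  s *: wedge (fam_map F (bc_tens _ 1 v)) (fam_map F (bc_tens _ 1 w)).
Proof.
rewrite -[LHS]/(ext2_map (fam_map F) (ext2_bc _ _ _)).
by rewrite ext2_bcE linearZ -ext2_mapE.
Qed.

Lemma pullback_mapE (k : fieldType) (W : lmodType k) (A B : kalg k) (h : kalg_hom A B)
    (F : qfamily W A) s w :
  fam_map (pullback h F) (bc_tens _ s w) = s *: bc_tens h 1 (fam_map F (bc_tens _ 1 w)).
Proof. exact: bc_liftE. Qed.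

Lemma plucker_pullback (k : fieldType) (W : lmodType k) (A B : kalg k) (h : kalg_hom A B)
    (F : qfamily W A) :
  fam_iso (plucker (pullback h F)) (pullback h (plucker F)).
Proof.
have bij := @ext2_bc_bij _ _ h (fam_mod F).
have [g [eg ge]] := linear_inv bij.
exists g; split; first by exists (ext2_bc h (fam_mod F)).
move=> x; rewrite -[RHS]eg; congr (g _).
pose l : {linear _ -> _} := fam_map (plucker (pullback h F)).
pose r : {linear _ -> _} := ext2_bc h (fam_mod F) \o fam_map (pullback h (plucker F)).
suff : l =1 r by [].
apply: bc_ext2_eq => v w; rewrite /l plucker_mapE !pullback_mapE !scale1r.
rewrite -[RHS]/(ext2_bc _ _ (fam_map (pullback h (plucker F)) _)).
by rewrite pullback_mapE plucker_mapE !scale1r ext2_bcE scale1r.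
Qed.

Lemma iso_of_ker (R : comPzRingType) (M U V : lmodType R)
    (f : {linear M -> U}) (g : {linear M -> V}) :
  (forall u, exists x, f x = u) -> (forall v, exists x, g x = v) ->
  (forall x, f x = 0 <-> g x = 0) ->
  exists h : {linear U -> V}, bijective h /\ forall x, h (f x) = g x.
Proof.
move=> /choice[p pK] /choice[q qK] fg.
have fgE x y : f x = f y <-> g x = g y.
  by split=> /eqP; rewrite -subr_eq0 -linearB => /eqP/fg/eqP;
     rewrite linearB subr_eq0 => /eqP.
pose h u := g (p u).
have hf x : h (f x) = g x by apply/fgE; rewrite pK.
have hl : linear h.
  move=> a u v; rewrite -(pK u) -(pK v) -linearP !hf; exact: linearP.
exists (HB.pack_for {linear U -> V} h (GRing.isLinear.Build _ _ _ _ _ hl)).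
split=> //; exists (fun v => f (q v)) => [u|v] /=; last by rewrite hf qK.
by rewrite -[RHS]pK; apply/fgE; rewrite qK.
Qed.

Section Plucker.
Variables (k : fieldType) (W : lmodType k) (A : kalg k).

Lemma plucker_wedge (x y : base_change (kalg_map A) W) :
  exists z, forall F : qfamily W A,
    fam_map (plucker F) z = wedge (fam_map F x) (fam_map F y).
Proof.
have [g _ ge] := @ext2_bc_bij _ _ (kalg_map A) W.
by exists (g (wedge x y)) => F; rewrite /= -ext2_mapE ge.
Qed.

Lemma ext2_map_iso (F G : qfamily W A) : fam_iso F G -> fam_iso (plucker F) (plucker G).
Proof.
case=> h [/linear_inv[g [hg gh]] hE]; exists (ext2_map h); split.
  exists (ext2_map g).
    elim/ext2_ind => [|x y|x y]; first by rewrite !linear0.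
      by rewrite !linearD => -> ->.
    by rewrite !ext2_mapE !hg.
  elim/ext2_ind => [|x y|x y]; first by rewrite !linear0.
    by rewrite !linearD => -> ->.
  by rewrite !ext2_mapE !gh.
have e w : ext2_map h (ext2_map (fam_map F) w) = ext2_map (fam_map G) w.
  elim/ext2_ind: w => [|y z|y z]; first by rewrite !linear0.
    by rewrite !linearD => -> ->.
  by rewrite !ext2_mapE !hE.
move=> x; exact: e.
Qed.

Lemma Gr_ker (F : qfamily W A) : Gr_point 2 F ->
  forall x, fam_map F x = 0 <-> forall y, wedge (fam_map F x) (fam_map F y) = 0.
Proof.
move=> [Ff Fs] x; split=> [-> y|x0]; first exact: (bil0l (wedge_alternating _).1).
by apply: (rank2_nondeg Ff) => v; have [y <-] := Fs v.
Qed.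

(** The kernel of a family is determined by the exterior square of the family:
    the plane is the quotient by those x with x /\ y = 0 for all y. *)
Lemma plucker_inj (F G : qfamily W A) : Gr_point 2 F -> Gr_point 2 G ->
  fam_iso (plucker F) (plucker G) -> fam_iso F G.
Proof.
move=> FP GP [h [hb hE]]; apply: iso_of_ker FP.2 GP.2 _ => x.
have hW y : h (wedge (fam_map F x) (fam_map F y)) = wedge (fam_map G x) (fam_map G y).
  by have [z zE] := plucker_wedge x y; rewrite -!zE.
rewrite (Gr_ker FP) (Gr_ker GP); split=> x0 y; first by rewrite -hW x0 linear0.
by apply: (bij_inj hb); rewrite hW x0 linear0.
Qed.

Lemma plucker_P_point (F : qfamily W A) : Gr_point 2 F -> P_point (plucker F).
Proof.
move=> [Ff Fs]; split; first exact: rank2_ext2.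
elim/ext2_ind => [|u v [x <-] [y <-]|u v]; first by exists 0; rewrite linear0.
  by exists (x + y); rewrite linearD.
have [[x <-] [y <-]] := (Fs u, Fs v).
by have [z zE] := plucker_wedge x y; exists z; rewrite zE.
Qed.

End Plucker.

Section Biseries.
Variables (k : fieldType) (A : kalg k).
Notation V := (biseries_dual k).
Notation AV := (base_change (kalg_map A) V).

Definition frame (i : int) : AV := bc_tens (kalg_map A) 1 (lambda_ k i).

Lemma frame_span (x : AV) : exists s : seq (A * int), x = \sum_(p <- s) p.1 *: frame p.2.
Proof.
elim/bc_ind: x => [|x y [s ->] [t ->]|a l]; first by exists [::]; rewrite big_nil.
  by exists (s ++ t); rewrite big_cat.
have [s {1}->] := dual_lambda l.
exists [seq (a * kalg_map A (l (tpow k i)), i) | i <- s]; rewrite big_map /=.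
rewrite (big_morph (bc_tens (kalg_map A) a) (id1 := 0) (op1 := +%R)).
- apply: eq_bigr => i _; rewrite bc_tensZr -scalerA scalerA mulrC -scalerA.
  by rewrite -[a in LHS]mulr1 bc_tensZl.
- exact: bc_tensDr.
by rewrite -(scale0r 0) bc_tensZr rmorph0 scale0r.
Qed.

Lemma plucker_eq_of_Gr (F : qfamily V A) : Gr_point 2 F -> plucker_equations (plucker F).
Proof.
move=> [Ff _] i j l m _ _ _.
have E a b : Delta (plucker F) a b = wedge (fam_map F (frame a)) (fam_map F (frame b)).
  by rewrite /Delta /= ext2_bcE scale1r ext2_mapE.
by rewrite !E; apply: (rank2_plucker Ff).
Qed.

(** The plane is the quotient of A (x) V by the radical of the alternating form
    that the point of projective space defines. *)
Lemma plucker_surj (G : qfamily (ext2 V) A) : P_point G -> plucker_equations G ->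
  exists F : qfamily V A, Gr_point 2 F /\ fam_iso (plucker F) G.
Proof.
move=> [Gf Gs] Geq.
have [g [eg ge]] := linear_inv (@ext2_bc_bij _ _ (kalg_map A) V).
pose D (p : AV * AV) := fam_map G (g (wedge p.1 p.2)).
have [[Wr Wl] Wa] := wedge_alternating AV.
have D_alt : alternating_map D.
  split; last by move=> x; rewrite /D /= [wedge x x]Wa !linear0.
  by split=> [x|y] a u v; rewrite /D /= ?[wedge _ (_ + _)]Wr ?[wedge (_ + _) _]Wl !linearP.
have D_gen u : exists s : seq (AV * AV), u = \sum_(p <- s) D p.
  have [z <-] := Gs u; rewrite -[z]eg; elim/ext2_ind: (ext2_bc _ _ z) => [|x y [s xs] [t yt]|x y].
  - by exists [::]; rewrite !linear0 big_nil.
  - by exists (s ++ t); rewrite !linearD xs yt big_cat.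
  - by exists [:: (x, y)]; rewrite big_seq1.
have DE i j : D (frame i, frame j) = Delta G i j.
  by rewrite /D /Delta -[X in fam_map G X = _]/(g _) -[bc_tens _ _ _ in RHS]eg ext2_bcE scale1r.
have D_plucker x y z w : plucker_form D x y z w = 0.
  apply: (plucker_form_span D_alt (rank1_tensC Gf) frame_span).
  apply: (plucker_form_sorted D_alt (rank1_tensC Gf)) => i m j l im mj jl.
  (* the given equations list the two middle indices in decreasing order *)
  apply/eqP; rewrite -oppr_eq0 -(plucker_form_swap23 D_alt) /plucker_form !DE.
  by rewrite Geq.
have [h [hb hE]] := ext2_quo D_alt Gf D_gen D_plucker.
exists (@QFamily k V A (quo D) (cl D : {linear AV -> quo D})); split.
  split; [exact: (quo_free D_alt Gf D_gen D_plucker) | exact: cl_surj].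
pose c : {linear AV -> quo D} := cl D.
have e w : h (ext2_map c w) = fam_map G (g w).
  elim/ext2_ind: w => [|u v|u v]; first by rewrite !linear0.
    by rewrite !linearD => -> ->.
  by rewrite ext2_mapE hE.
exists h; split=> // x; rewrite -[x in RHS]eg; exact: e.
Qed.

End Biseries.

Theorem corollaryA4 (k : fieldType) :
  [/\ (forall (A B : kalg k) (h : kalg_hom A B)
          (F : qfamily (biseries_dual k) A),
        Gr_point 2 F ->
        fam_iso (plucker (pullback h F)) (pullback h (plucker F))),
      (forall (A : kalg k) (F : qfamily (biseries_dual k) A),
        Gr_point 2 F ->
        P_point (plucker F) /\ plucker_equations (plucker F)),
      (forall (A : kalg k) (F G : qfamily (biseries_dual k) A),
        Gr_point 2 F -> Gr_point 2 G ->
        (fam_iso (plucker F) (plucker G) <-> fam_iso F G)) &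
      (forall (A : kalg k) (G : qfamily (ext2 (biseries_dual k)) A),
        P_point G -> plucker_equations G ->
        exists F : qfamily (biseries_dual k) A,
          Gr_point 2 F /\ fam_iso (plucker F) G)].
Proof.
split.
- by move=> A B h F _; apply: plucker_pullback.
- by move=> A F FP; split; [apply: plucker_P_point | apply: plucker_eq_of_Gr].
- by move=> A F G FP GP; split; [apply: plucker_inj | apply: ext2_map_iso].
- by move=> A G; apply: plucker_surj.
Qed.
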